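(* Let $\alpha>0$ and let $X(t)$, $t\in\mathcal{T}$, where $\mathcal{T}=\mathbb{R}$ or $\mathcal{T}=\mathbb{Z}$, be a separable stationary max-stable process with Fréchet marginals $\Phi_\alpha(x)=e^{-x^{-\alpha}}$, $x>0$, with locally bounded sample paths and de Haan representation with spectral process $Z$. For $T>0$ put $$A_T=T^{-1/\alpha}\sup_{t\in[0,T]\cap\mathcal{T}}X(t).$$ Then for any $\beta\in(0,\alpha)$, $$\lim_{T\to\infty}\mathbb{E}\{A_T^\beta\}=\mathcal{H}^{\beta/\alpha}\,\Gamma(1-\beta/\alpha)<\infty,$$ where $\Gamma$ is the Euler Gamma function and $\mathcal{H}$ is the Pickands constant of $X$; and moreover $A_T^\beta$, $T>0$, is uniformly integrable for any $\beta\in(0,\alpha)$.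
   Context: A process is max-stable if its finite-dimensional distributions are max-stable multivariate distributions. A non-negative process $Z(t)$, $t\in\mathcal{T}$, is a spectral process of $X$ if, in distribution, $X(t)=\max_{i\ge1}P_iZ^{(i)}(t)$, $t\in\mathcal{T}$ (de Haan representation), where $\sum_i\varepsilon_{P_i}$ is a Poisson point process on $[0,\infty)$ with intensity $\alpha x^{-\alpha-1}dx$, independent of the $Z^{(i)}$, which are independent copies of $Z$. The marginal assumption on $X$ implies $\mathbb{E}\{Z^\alpha(t)\}=1$ for all $t$. Standing assumptions when $\mathcal{T}=\mathbb{R}$: $X$ is stochastically continuous, and $X$ and $Z$ are jointly measurable, separable, with locally bounded sample paths. The Pickands constant is $\mathcal{H}=\lim_{T\to\infty}\frac1T\mathbb{E}\{\sup_{t\in[0,T]\cap\mathcal{T}}Z^\alpha(t)\}\in[0,\infty)$; the limit exists and depends only on $X$.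
   Formalization: Uniform integrability of A_T^β is stated for T ≥ T0, for every T0 > 0, instead of all T > 0: over all T > 0 it is false, since A_T ≥ T^{-1/α}X(0) makes E{A_T^β} tend to infinity as T → 0. *)

(* Defs.v *)
From HB Require Import structures.
From mathcomp Require Import all_boot all_order all_algebra finmap.
From mathcomp Require Import all_classical all_reals all_analysis.
From mathcomp Require Import measurable_realfun.
Set Implicit Arguments.
Unset Strict Implicit.
Unset Printing Implicit Defensive.
Import Order.TTheory GRing.Theory Num.Theory.
Import numFieldNormedType.Exports.
Local Open Scope classical_set_scope.
Local Open Scope ring_scope.

(* A process with time set I (I : set R, either R itself or the integers inside
   R) is a family indexed by all of R; only its values at times of I matter. *)
Definition time_domain (R : realType) (I : set R) : Prop :=
  I = [set: R] \/ I = range (fun n : int => n%:~R).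

Section processes.
Context (R : realType) (d : measure_display) (Omega : measurableType d).
Implicit Types (P : probability Omega R) (I : set R) (X : R -> Omega -> R).

Definition stochastic_process dE (E : measurableType dE) I
    (X : R -> Omega -> E) : Prop :=
  forall t, I t -> measurable_fun [set: Omega] (X t).

Definition jointly_measurable X : Prop :=
  measurable_fun [set: measurableTypeR R * Omega] (fun p => X p.1 p.2).

Definition stochastically_continuous P X : Prop :=
  forall (t e : R), 0 < e ->
    P [set w | e <= `|X s w - X t w|] @[s --> t] --> 0%E.

(* Separability in the sense of Doob, with separant D; a single null set serves
   all t. The condition forces D to be dense in I. *)
Definition separable_process P I X : Prop :=
  exists D : set R, [/\ countable D, D `<=` I &
    {ae P, forall w, forall t, I t -> forall U, nbhs t U ->
      closure [set X s w | s in D `&` U] (X t w)}].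

Definition locally_bounded_paths P I X : Prop :=
  {ae P, forall w, forall r : R, exists M : R,
    forall t, I t -> `|t| <= r -> `|X t w| <= M}.

Definition frechet_marginals P I (alpha : R) X : Prop :=
  forall t, I t -> forall x : R, 0 < x ->
    P [set w | X t w <= x] = (expR (- (x `^ (- alpha))))%:E.

Definition fdd_cdf P X n (t : 'I_n -> R) (x : 'I_n -> R) : \bar R :=
  P [set w | forall i, X (t i) w <= x i].

Definition max_stable_cdf n (F : ('I_n -> R) -> \bar R) : Prop :=
  forall k : nat, (0 < k)%N -> exists a b : 'I_n -> R,
    (forall i, 0 < a i) /\
    forall x, (F (fun i => a i * x i + b i)%R ^+ k = F x)%E.

Definition max_stable_process P I X : Prop :=
  forall n (t : 'I_n -> R), (forall i, I (t i)) ->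
    max_stable_cdf (fdd_cdf P X t).

End processes.

Definition eq_fdd (R : realType) (dE : measure_display) (E : measurableType dE)
    (I : set R)
    (d1 : measure_display) (O1 : measurableType d1) (P1 : probability O1 R)
    (X1 : R -> O1 -> E)
    (d2 : measure_display) (O2 : measurableType d2) (P2 : probability O2 R)
    (X2 : R -> O2 -> E) : Prop :=
  forall n (t : 'I_n -> R), (forall i, I (t i)) ->
  forall B : set (n.-tuple E), measurable B ->
    P1 [set w | B [tuple X1 (t i) w | i < n]] =
    P2 [set w | B [tuple X2 (t i) w | i < n]].

Definition stationary (R : realType) (d : measure_display)
    (Omega : measurableType d) (P : probability Omega R) (I : set R)
    (X : R -> Omega -> R) : Prop :=
  forall h, I h -> eq_fdd I P (fun t => X (t + h)) P X.

Section independence.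
Context (R : realType) (d : measure_display) (Omega : measurableType d).
Implicit Types (P : probability Omega R).

Definition mutually_independent P (K : choiceType)
    (F : K -> set (set Omega)) : Prop :=
  forall (J : {fset K}) (A : K -> set Omega),
    (forall j, j \in J -> F j (A j)) ->
    (P (\bigcap_(j in [set` J]) A j) = \prod_(j <- J) P (A j))%E.

Definition sigma_of_process (S : Type) (I : set S) dE (E : measurableType dE)
    (X : S -> Omega -> E) : set (set Omega) :=
  <<s \bigcup_(t in I) g_sigma_algebra_preimage (X t) >>.

End independence.

Section poisson_point_process.
Context (R : realType) (d : measure_display) (Omega : measurableType d).
Local Open Scope ereal_scope.

Definition point_count (G : nat -> Omega -> R) (B : set R) (w : Omega)
    : \bar R :=
  \sum_(i <oo) \d_(G i w) B.

(* The Poisson probabilities are spelled out because poisson_pmf is 1 for the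
   rate 0. *)
Definition poisson_point_process (P : probability Omega R)
    (Lambda : set R -> \bar R) (G : nat -> Omega -> R) : Prop :=
  [/\ forall i, measurable_fun [set: Omega] (G i),
      forall B : set R, measurable B -> Lambda B < +oo -> forall k : nat,
        let l := fine (Lambda B) in
        P [set w | point_count G B w = k%:R%:E] =
          (expR (- l) * l ^+ k / (k`!)%:R)%:E,
      forall B : set R, measurable B -> Lambda B = +oo ->
        P [set w | point_count G B w = +oo] = 1 &
      forall B : nat -> set R, (forall j, measurable (B j)) ->
        trivIset [set: nat] B ->
        mutually_independent P
          (fun j => preimage_set_system [set: Omega] (point_count G (B j))
                      measurable)].

Definition frechet_intensity (alpha : R) (B : set R) : \bar R :=
  \int[lebesgue_measure]_(x in B `&` `]0%R, +oo[)
    (alpha * x `^ (- alpha - 1))%:E.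

End poisson_point_process.

(* De Haan representation. Mutual independence is indexed by option nat: None is
   the whole sequence of points (as an enumerated sequence, not only through the
   point process it generates), Some i is the i-th copy of Z. *)
Definition spectral_process (R : realType) (I : set R) (alpha : R)
    (d : measure_display) (Omega : measurableType d) (P : probability Omega R)
    (X : R -> Omega -> R)
    (d' : measure_display) (Omega' : measurableType d')
    (P' : probability Omega' R) (Z : R -> Omega' -> R) : Prop :=
  [/\ stochastic_process I Z,
      forall t w, I t -> 0 <= Z t w &
      exists (dQ : measure_display) (OQ : measurableType dQ)
        (Q : probability OQ R) (G : nat -> OQ -> R) (W : nat -> R -> OQ -> R),
      [/\ (forall i w, 0 <= G i w) /\
            poisson_point_process Q (frechet_intensity alpha) G,
          forall i, stochastic_process I (W i),
          forall i, eq_fdd I Q (W i) P' Z,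
          mutually_independent Q (fun k : option nat =>
            if k is Some i then sigma_of_process I (W i)
            else sigma_of_process [set: nat] G) &
          eq_fdd I P (fun t w => (X t w)%:E)
                 Q (fun t w => ereal_sup
                      (range (fun i => (G i w * W i t w)%:E)))]].

Section suprema.
Context (R : realType) (d : measure_display) (Omega : measurableType d).
Implicit Types (P : probability Omega R) (I : set R) (X Z : R -> Omega -> R).
Local Open Scope ereal_scope.

Definition sup_upto I (T : R) (f : R -> R) : \bar R :=
  ereal_sup [set (f t)%:E | t in `[0%R, T] `&` I].

Definition normalized_sup I (alpha : R) X (T : R) (w : Omega) : \bar R :=
  (T `^ (- alpha^-1))%R%:E * sup_upto I T (X ^~ w).

Definition pickands P I (alpha : R) Z : \bar R :=
  lim ((T^-1)%:E * \int[P]_w sup_upto I T (fun t => Z t w `^ alpha)%R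
       @[T --> +oo%R]).

Definition uniformly_integrable P (S : Type) (D : set S)
    (Y : S -> Omega -> \bar R) : Prop :=
  ereal_sup [set \int[P]_(w in [set w | c%:E < `|Y i w|]) `|Y i w| | i in D]
    @[c --> +oo%R] --> 0.

End suprema.

Definition Gamma (R : realType) (x : R) : \bar R :=
  (\int[lebesgue_measure]_(t in `]0%R, +oo[)
    (t `^ (x - 1) * expR (- t))%:E)%E.

(* Main.v *)
(* Put H(T) = E sup_{[0,T]} Z^alpha. By the marking theorem for the Poisson
   process of the de Haan representation, sup_{[0,T]} X has the Frechet
   distribution function exp(- H(T) x^(-alpha)). Hence A_T is c^(1/alpha) times
   a power of a standard exponential variable, with c = H(T) / T, and
   E A_T^beta = (H(T) / T)^(beta/alpha) Gamma(1 - beta/alpha). Stationarity of X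
   makes H subadditive and bounded paths make it finite, so that H(T) / T
   converges (Fekete). For T >= T0 it is also bounded, so the moments of A_T of
   an order in ]beta, alpha[ are bounded, whence the uniform integrability.

   Suprema over uncountable sets need not be measurable; the integral of such a
   nonnegative function is a lower integral, which does not change on null sets,
   and separability allows one to replace it with a countable supremum. *)
Require Import Defs.
From HB Require Import structures.
From mathcomp Require Import all_boot all_order all_algebra finmap.
From mathcomp Require Import all_classical all_reals all_analysis.
From mathcomp Require Import measurable_realfun.
From mathcomp Require Import ring lra.
Set Implicit Arguments.
Unset Strict Implicit.
Unset Printing Implicit Defensive.
Import Order.TTheory GRing.Theory Num.Theory.
Import numFieldNormedType.Exports.
Local Open Scope classical_set_scope.
Local Open Scope ring_scope.

(** * Integrals of nonnegative functions that need not be measurable *)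

(** The obstacle in the marking step is that the Poisson hypothesis speaks only of counts, while the
    points accumulate at 0 with infinite mass. The marks are therefore cut down to finitely many
    levels. The event that no marked point exceeds x then sees the points only through their counts
    in finitely many bins away from 0, and averaging out the marks gives every point of bin k one
    factor p_k. The expectation of the resulting product is a Poisson generating function, and
    summation by parts turns its exponent into an alpha-th moment.

    The law is proved with this moment possibly infinite, and finiteness of H(T) is read off from
    it.

    Z itself need not be stationary. Subadditivity of H passes through X: the law of the supremum of
    X over a sequence of times determines the moment of Z over the same sequence, so one sequence
    has to serve both processes. All shifts are by integers, which covers both time sets at once. *)

Section upper_integral.
Context d (T : measurableType d) (R : realType).
Local Open Scope ereal_scope.
Implicit Types (mu : {measure set T -> \bar R}) (f g : T -> \bar R).

(** The integral of a nonnegative function is a supremum over the simple functions below it, and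
    that family grows with the function. *)
Lemma ge0_le_integralT mu f g : (forall x, 0 <= f x) ->
  (forall x, f x <= g x) -> \int[mu]_x f x <= \int[mu]_x g x.
Proof.
move=> f0 fg.
have g0 x : 0 <= g x by exact: le_trans (f0 x) (fg x).
rewrite !ge0_integralTE//; apply: ge_ereal_sup => _ [h /= hf <-].
by apply: ereal_sup_ubound; exists h => // x; exact: le_trans (hf x) (fg x).
Qed.

Import HBNNSimple.

(** A simple function below f is set to 0 on a measurable null set containing the exceptional
    points. It keeps its integral and now lies below g everywhere. *)
Lemma ae_le_integralT mu f g : (forall x, 0 <= f x) -> (forall x, 0 <= g x) ->
  {ae mu, forall x, f x <= g x} -> \int[mu]_x f x <= \int[mu]_x g x.
Proof.
move=> f0 g0 [N [mN N0 subN]].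
rewrite [leLHS]ge0_integralTE//; apply: ge_ereal_sup => _ [h /= hf <-].
pose h' : {nnsfun T >-> R} := proj_nnsfun h (measurableC mN).
have h'E x : h' x = (h \_ (~` N)) x by rewrite (mrestrict h (measurableC mN)).
rewrite -integralT_nnsfun (@ge0_ae_eq_integral _ _ _ _ _ _ (EFin \o h'))//.
- apply: ge0_le_integralT => x; first by rewrite lee_fin.
  change ((h' x)%:E <= g x); rewrite h'E patchE; case: ifPn => [|_]; last exact: g0.
  rewrite inE => xN; apply: le_trans (hf x) _.
  by apply: contrapT => fg; apply: xN; exact: subN.
- exact/measurable_EFinP.
- exact/measurable_EFinP.
- by move=> x _; rewrite lee_fin.
- by move=> x _; rewrite lee_fin.
exists N; split => // x /=; apply: contra_notP => xN _.
by change (EFin (h x) = EFin (h' x)); rewrite h'E patchE mem_set.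
Qed.

Lemma ae_eq_integralT mu f g : (forall x, 0 <= f x) -> (forall x, 0 <= g x) ->
  {ae mu, forall x, f x = g x} -> \int[mu]_x f x = \int[mu]_x g x.
Proof.
move=> f0 g0 fg; apply/eqP; rewrite eq_le; apply/andP; split.
  by apply: ae_le_integralT => //; apply: filterS fg => x /= ->.
by apply: ae_le_integralT => //; apply: filterS fg => x /= ->.
Qed.

End upper_integral.

Section product_of_sums.
Context d (T : measurableType d) (R : realType).
Local Open Scope ereal_scope.

(** Expanding the product over the choices f of one term per factor leaves probabilities of
    intersections, the form on which independence acts. It serves both for counts and for marks. *)
Lemma integral_prod_sum_indic (mu : {measure set T -> \bar R}) (n m : nat)
    (c : 'I_n -> 'I_m -> R) (A : 'I_n -> 'I_m -> set T) :
  (forall j k, measurable (A j k)) -> (forall j k, (0 <= c j k)%R) ->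
  \int[mu]_x (\prod_(j < n) \sum_(k < m) c j k * \1_(A j k) x)%R%:E =
  \sum_(f : {ffun 'I_n -> 'I_m})
    (\prod_(j < n) c j (f j))%R%:E * mu (\bigcap_(j in [set: 'I_n]) A j (f j)).
Proof.
move=> mA c0.
have mcap (f : {ffun 'I_n -> 'I_m}) :
    measurable (\bigcap_(j in [set: 'I_n]) A j (f j)).
  by apply: fin_bigcap_measurable => //; exact: finite_finset.
have prod1 (f : {ffun 'I_n -> 'I_m}) x : (\prod_(j < n) \1_(A j (f j)) x =
    \1_(\bigcap_(j in [set: 'I_n]) A j (f j)) x :> R)%R.
  rewrite !indicE; case: (asboolP ((\bigcap_(j in [set: 'I_n]) A j (f j)) x)).
    move=> /[dup] xA /mem_set ->; apply: big1 => j _.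
    by rewrite indicE mem_set//; exact: xA.
  move=> xA; rewrite [in RHS]memNset//.
  have /existsNP[j Aj] : ~ (forall j, A j (f j) x).
    by apply: contra_not xA => xA j _.
  by rewrite (bigD1 j)//= indicE memNset// mul0r.
transitivity (\int[mu]_x \sum_(f : {ffun 'I_n -> 'I_m})
    (\prod_(j < n) c j (f j))%R%:E *
    (\1_(\bigcap_(j in [set: 'I_n]) A j (f j)) x)%:E).
  apply: eq_integral => x _; rewrite bigA_distr_bigA/= -sumEFin.
  by apply: eq_bigr => f _; rewrite big_split/= prod1 EFinM.
have prod_ge0 (f : {ffun 'I_n -> 'I_m}) : (0 <= \prod_(j < n) c j (f j))%R.
  by apply: prodr_ge0.
rewrite ge0_integral_sum//.
- apply: eq_bigr => f _; rewrite ge0_integralZl//.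
  + by rewrite integral_indic// setIT.
  + exact/measurable_EFinP.
  + by rewrite lee_fin.
- move=> f; apply: measurable_funeM.
  exact/measurable_EFinP.
- by move=> f x _; rewrite -EFinM lee_fin mulr_ge0// prod_ge0.
Qed.

End product_of_sums.

(** * Poisson counts *)

Section independence_of_finite_families.
Context d (T : measurableType d) (R : realType).

Lemma mutually_independent_bigcap (P : probability T R) (K : choiceType)
    (F : K -> set (set T)) (J : finType) (e : J -> K) (A : J -> set T) :
  mutually_independent P F -> injective e -> (forall j, F (e j) (A j)) ->
  (P (\bigcap_(j in [set: J]) A j) = \prod_j P (A j))%E.
Proof.
move=> indep e_inj FA.
(* Independence quantifies over families indexed by all of K, so A is transported along e and filled
   up with the full space. *)
pose A' x := if [pick j | e j == x] is Some j then A j else setT.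
have A'E j : A' (e j) = A j.
  rewrite /A'; case: pickP => [i /eqP /e_inj -> //|/(_ j)].
  by rewrite eqxx.
pose S := [fset e j | j in J]%fset.
have /(indep S A') : forall x, x \in S -> F x (A' x).
  by move=> x /imfsetP[j _ ->]; rewrite A'E.
rewrite big_imfset//=; last by move=> ? ? _ _; exact: e_inj.
rewrite big_enum/= => indepS.
under [RHS]eq_bigr do rewrite -A'E.
rewrite -indepS; congr (P _); apply/seteqP; split => w /= wA.
  by move=> x /= /imfsetP[j _ ->]; rewrite A'E; exact: wA.
by move=> j _; rewrite -A'E; apply: wA; apply/imfsetP; exists j.
Qed.

End independence_of_finite_families.

Section point_counts.
Context d (T : measurableType d) (R : realType).
Implicit Types (G : nat -> T -> R) (B : set R).

Lemma measurable_point_count G B : (forall i, measurable_fun [set: T] (G i)) ->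
  measurable B -> measurable_fun [set: T] (point_count G B).
Proof.
move=> mG mB; apply: ge0_emeasurable_sum => // i _.
rewrite (_ : (fun w => _) = EFin \o (\1_B \o G i)); last first.
  by apply/funext => w; rewrite /= diracE indicE.
by apply/measurable_EFinP; apply: measurableT_comp.
Qed.

(** The partial sums are nondecreasing integers. If they never reached k they would be at most k -
    1, and so would their limit. *)
Lemma near_point_count G B w (k : nat) : point_count G B w = k%:R%:E ->
  \forall n \near \oo, (\sum_(j < n) (G j w \in B) = k)%N.
Proof.
move=> Nk; pose c n := (\sum_(0 <= j < n) (G j w \in B))%N.
have cE n : (\sum_(0 <= j < n) \d_(G j w) B = (c n)%:R%:E)%E.
  rewrite /c natr_sum -sumEFin; apply: eq_bigr => j _.
  by rewrite diracE.
have c_nd m n : (m <= n)%N -> (c m <= c n)%N.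
  by move=> mn; rewrite /c (big_cat_nat (leq0n m) mn)/= leq_addr.
have c_le n : (c n <= k)%N.
  rewrite -(ler_nat R) -lee_fin -Nk -cE.
  by apply: nneseries_lim_ge.
have [n0 cn0] : exists n, c n = k.
  apply/not_existsP => cNk.
  have {}c_le n : (c n <= k.-1)%N.
    by have := c_le n; rewrite leq_eqVlt => /orP[/eqP /cNk //|]; case: (k).
  have k0 : (0 < k)%N by have := cNk 0%N; rewrite /c big_geq//; case: (k).
  suff : (point_count G B w <= k.-1%:R%:E)%E.
    by rewrite Nk lee_fin ler_nat -ltnS prednK// ltnn.
  apply: lime_le; first exact: is_cvg_nneseries.
  by apply: nearW => n; rewrite cE lee_fin ler_nat.
exists n0 => // n /= n0n; apply/eqP.
by rewrite eqn_leq -(big_mkord predT (fun j => nat_of_bool (G j w \in B)))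
  c_le -cn0 c_nd.
Qed.

Lemma cvg_poisson_pgf (l p : R) :
  (\sum_(i < n) p ^+ i * (expR (- l) * l ^+ i / (i`!)%:R)) @[n --> \oo] -->
  expR (- l * (1 - p)).
Proof.
have -> : expR (- l * (1 - p)) = expR (- l) * expR (l * p).
  by rewrite -expRD; congr expR; ring.
rewrite (_ : (fun n => _) = (fun n => expR (- l) * series (exp_coeff (l * p)) n)).
  by apply: cvgMl_tmp; exact: is_cvg_series_exp_coeff.
apply/funext => n; rewrite /series/= big_mkord mulr_sumr; apply: eq_bigr => i _.
by rewrite /exp_coeff/= exprMn; ring.
Qed.

(** The product over the points is the product over the bins of p k raised to the count of bin k.
    Counts of disjoint bins are independent, so its expectation is a product of Poisson generating
    functions. *)
Lemma poisson_pgf (P : probability T R) (Lambda : set R -> \bar R) G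
    (B : nat -> set R) (m : nat) (p : 'I_m -> R) :
  poisson_point_process P Lambda G ->
  (forall k, measurable (B k)) -> trivIset [set: nat] B ->
  (forall k, (k < m)%N -> (Lambda (B k) < +oo)%E) ->
  (forall k, 0 <= p k <= 1) ->
  (\int[P]_w (\prod_(j < n) \prod_(k < m) p k ^+ (G j w \in B k))%:E
     @[n --> \oo] -->
  (\prod_(k < m) expR (- fine (Lambda (B k)) * (1 - p k)))%:E)%E.
Proof.
move=> [mG countB _ indep] mB tB LB p01.
pose N k := point_count G (B k).
have mN k : measurable_fun [set: T] (N k) by exact: measurable_point_count.
have mN1 k (x : \bar R) : measurable [set w | N k w = x].
  by have := mN k measurableT [set x] (emeasurable_set1 x); rewrite setTI.
have NE (k : 'I_m) (i : nat) : P [set w | N k w = i%:R%:E] =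
    (expR (- fine (Lambda (B k))) * fine (Lambda (B k)) ^+ i / (i`!)%:R)%:E.
  by apply: countB => //; exact: LB.
(* V n keeps the first n points, U n keeps counts below n. Both lie in [0, 1] and are almost surely
   eventually constant with the same value. The integral of U n is computable by independence, and
   dominated convergence carries its limit over to V n. *)
pose V n w : R := \prod_(j < n) \prod_(k < m) p k ^+ (G j w \in B k).
pose U n w : R :=
  \prod_(k < m) \sum_(i < n) p k ^+ i * \1_[set w | N k w = i%:R%:E] w.
have intU : (\int[P]_w (U n w)%:E @[n --> \oo] -->
    (\prod_(k < m) expR (- fine (Lambda (B k)) * (1 - p k)))%:E)%E.
  have -> : (fun n => \int[P]_w (U n w)%:E)%E =
     (fun n => (\prod_(k < m) \sum_(i < n) p k ^+ i *
       (expR (- fine (Lambda (B k))) * fine (Lambda (B k)) ^+ i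
        / (i`!)%:R))%:E)%E.
    apply/funext => n; rewrite (@integral_prod_sum_indic _ _ _ P m n
      (fun k i => p k ^+ i) (fun k i => [set w | N k w = i%:R%:E]))//; last first.
      by move=> k i; rewrite exprn_ge0//; case/andP: (p01 k).
    rewrite bigA_distr_bigA/= -sumEFin; apply: eq_bigr => f _.
    rewrite big_split/= EFinM; congr (_ * _)%E.
    rewrite (@mutually_independent_bigcap _ _ _ P _ _ _ val _ (indep B mB tB)).
    - by rewrite -prodEFin; apply: eq_bigr => k _; exact: NE.
    - exact: val_inj.
    move=> k; exists [set (f k)%:R%:E]; first exact: emeasurable_set1.
    by rewrite setTI.
  apply: cvg_EFin; first exact: nearW.
  apply: cvg_big => [|k _]; first exact: mul_continuous.
  exact: cvg_poisson_pgf.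
have p_ge0 k : 0 <= p k by case/andP: (p01 k).
have p_X01 k i : 0 <= p k ^+ i <= 1.
  by rewrite exprn_ge0//= exprn_ile1//; case/andP: (p01 k).
have prod01 (J : finType) (F : J -> R) : (forall j, 0 <= F j <= 1) ->
    0 <= \prod_j F j <= 1.
  move=> F01; rewrite prodr_ge0 => [|j _]; last by case/andP: (F01 j).
  exact: prodr_ile1.
have V01 n w : 0 <= V n w <= 1 by apply: (prod01) => j; exact: prod01.
have term_eq (k : 'I_m) n w (i : 'I_n) : N k w = i%:R%:E ->
    \sum_(i < n) p k ^+ i * \1_[set w | N k w = i%:R%:E] w = p k ^+ i.
  move=> Nki; rewrite (bigD1 i)//= indicE mem_set// mulr1 big1 ?addr0// => l li.
  rewrite indicE memNset ?mulr0//= Nki => -[] /eqP.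
  by rewrite eqr_nat => /eqP il; move: li; rewrite -val_eqE/= il eqxx.
have U01 n w : 0 <= U n w <= 1.
  have S01 (k : 'I_m) :
      0 <= \sum_(i < n) p k ^+ i * \1_[set w | N k w = i%:R%:E] w <= 1.
    have [[i Nki]|noN] := pselect (exists i : 'I_n, N k w = i%:R%:E).
      by rewrite (term_eq _ _ _ _ Nki).
    rewrite big1 ?lexx ?ler01// => i _; rewrite indicE memNset ?mulr0//= => Nki.
    by apply: noN; exists i.
  exact: prod01.
(* The Poisson probabilities add up to 1, which is the generating function at p = 1, so the counts
   are almost surely finite. *)
have N_fin : {ae P, forall w, forall k : nat, (k < m)%N ->
    exists i : nat, N k w = i%:R%:E}.
  apply: ae_foralln => k; have [km|mk] := ltnP k m; last exact: nearW.
  pose E := \bigcup_(i in [set: nat]) [set w | N k w = i%:R%:E].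
  have mE : measurable E by apply: bigcupT_measurable => i; exact: mN1.
  have PE : P E = 1%E.
    rewrite measure_bigcup//; last first.
      move=> i j _ _ [w [/= ->]] [] /eqP; rewrite eqr_nat => /eqP; exact.
    apply/cvg_lim => //.
    rewrite (_ : (fun n => _) = (fun n => (\sum_(i < n) 1 ^+ i *
      (expR (- fine (Lambda (B k))) * fine (Lambda (B k)) ^+ i
        / (i`!)%:R))%:E)); last first.
      apply/funext => n; rewrite big_mkord -sumEFin.
      rewrite (eq_bigl predT) => [|i]; last by rewrite mem_set.
      apply: eq_bigr => i _.
      by rewrite expr1n mul1r; exact: (NE (Ordinal km) i).
    rewrite -[X in _ --> X](_ : (expR (- fine (Lambda (B k)) * (1 - 1)))%:E = _);
      last by rewrite subrr mulr0 expR0.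
    by apply: cvg_EFin; [exact: nearW|exact: cvg_poisson_pgf].
  exists (~` E); split => //; first exact: measurableC.
    by have := probability_setC P mE; rewrite PE subee.
  move=> w /= /not_implyP[_ noN] [i _ Ni]; apply: noN.
  by exists i.
have near_VU w : (forall k : nat, (k < m)%N -> exists i : nat, N k w = i%:R%:E) ->
    exists v, (\forall n \near \oo, V n w = v) /\ (\forall n \near \oo, U n w = v).
  move=> Nfin; have /choice[h Nh] (k : 'I_m) : exists i : nat, N k w = i%:R%:E.
    exact: Nfin.
  exists (\prod_(k < m) p k ^+ h k); split.
    have : \forall n \near \oo, forall k : 'I_m,
        (\sum_(j < n) (G j w \in B k) = h k)%N.
      by apply: filter_forall => k; exact: near_point_count (Nh k).
    apply: filterS => n cn; rewrite /V exchange_big/=; apply: eq_bigr => k _.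
    by rewrite prodrXr cn.
  have : \forall n \near \oo, forall k : 'I_m, (h k < n)%N.
    by apply: filter_forall => k; exact: nbhs_infty_gt.
  apply: filterS => n hn; rewrite /U; apply: eq_bigr => k _.
  exact: (term_eq k n w (Ordinal (hn k)) (Nh k)).
have mV n : measurable_fun [set: T] (EFin \o V n).
  apply/measurable_EFinP; apply: measurable_prod => j _.
  apply: measurable_prod => k _.
  rewrite (_ : (fun w => _) = (fun w => 1 - (1 - p k) * \1_(B k) (G j w))).
    apply: measurable_funB => //; apply: measurable_funM => //.
    exact: measurableT_comp.
  apply/funext => w; rewrite indicE.
  by case: (G j w \in B k) => /=; ring.
have mU n : measurable_fun [set: T] (EFin \o U n).
  apply/measurable_EFinP; apply: measurable_prod => k _.
  by apply: measurable_sum => i; apply: measurable_funM.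
(* An upper limit is measurable and defined everywhere; off a null set it is the common eventual
   value of U n and V n. *)
pose f w := limn_esup (fun n => (U n w)%:E).
have mf : measurable_fun [set: T] f by exact: measurable_fun_limn_esup.
have near_cvg (u : R^nat) v : (\forall n \near \oo, u n = v) ->
    ((u n)%:E @[n --> \oo] --> v%:E)%E.
  move=> uv; apply: cvg_near_cst.
  by apply: filterS uv => n ->.
have fE w v : (\forall n \near \oo, U n w = v) -> f w = v%:E.
  move=> /near_cvg Uv; rewrite /f is_cvg_limn_esupE.
    exact/cvg_lim.
  by apply/cvg_ex; exists v%:E.
have cvg_int (W : nat -> T -> R) : (forall n w, 0 <= W n w <= 1) ->
    (forall n, measurable_fun [set: T] (EFin \o W n)) ->
    {ae P, forall w, (W n w)%:E @[n --> \oo] --> f w}%E ->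
    (\int[P]_w (W n w)%:E @[n --> \oo] --> \int[P]_w f w)%E.
  move=> W01 mW Wf.
  have [] // := @dominated_convergence _ _ _ P _ measurableT
    (fun n => EFin \o W n) f (EFin \o cst 1%R).
  - by apply: filterS Wf.
  - exact: finite_measure_integrable_cst.
  - apply: nearW => w n _ /=.
    by rewrite lee_fin ger0_norm; case/andP: (W01 n w).
have cvgU : (\int[P]_w (U n w)%:E @[n --> \oo] --> \int[P]_w f w)%E.
  apply: cvg_int => //; apply: filterS N_fin => w /near_VU[v [_ Uv]].
  by rewrite (fE w v Uv); exact: near_cvg.
have cvgV : (\int[P]_w (V n w)%:E @[n --> \oo] --> \int[P]_w f w)%E.
  apply: cvg_int => //; apply: filterS N_fin => w /near_VU[v [Vv Uv]].
  by rewrite (fE w v Uv); exact: near_cvg.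
rewrite (_ : (\prod_(k < m) _)%:E = \int[P]_w f w)%E//.
exact: (cvg_unique _ intU cvgU).
Qed.

End point_counts.

(** * Marked Poisson processes with Frechet intensity *)

Section frechet_intensity.
Context (R : realType) (alpha : R) (alpha_gt0 : 0 < alpha).
Local Notation mu := (@lebesgue_measure R).

Lemma cvg_powRN_pinfty : x `^ (- alpha) @[x --> +oo%R] --> (0 : R).
Proof.
apply/cvgrPdist_lt => e e0; near=> x.
have e1_gt0 : 0 < e `^ (- alpha^-1) by exact: powR_gt0.
have x_gt : e `^ (- alpha^-1) < x.
  by near: x; apply: nbhs_pinfty_gt; rewrite num_real.
have x0 : 0 < x by exact: lt_trans x_gt.
rewrite sub0r normrN ger0_norm ?powR_ge0// powRN.
rewrite invf_plt ?posrE ?powR_gt0//.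
rewrite -[ltLHS](_ : (e `^ (- alpha^-1)) `^ alpha = _); last first.
  by rewrite -powRrM mulNr mulVf ?gt_eqF// powR_inv1// ltW.
by rewrite gt0_ltr_powR// nnegrE ltW.
Unshelve. all: end_near. Qed.

Let density (x : R) := (alpha * x `^ (- alpha - 1))%:E.

Let measurable_density (D : set R) : measurable_fun D density.
Proof.
apply: measurable_funTS; apply/measurable_EFinP.
by apply: measurable_funM => //; exact: measurable_powR.
Qed.

Let density_ge0 x : (0 <= density x)%E.
Proof. by rewrite lee_fin mulr_ge0 ?powR_ge0 ?ltW. Qed.

Let continuous_powR_gt0 (p x : R) : 0 < x -> {for x, continuous (@powR R ^~ p)}.
Proof.
move=> x0; apply/differentiable_continuous/derivable1_diffP.
by apply: derivable_powR; rewrite in_itv/= x0.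
Qed.

(** For v = 0 the set is empty and the power of 0 vanishes. Otherwise it is the half line above x /
    v, and - r ^ (- alpha) is a primitive of the density. This is where the alpha-th power of the
    mark comes from. *)
Lemma frechet_intensity_tail (x v : R) : 0 < x -> 0 <= v ->
  frechet_intensity alpha [set r | x < r * v] = (x `^ (- alpha) * v `^ alpha)%:E.
Proof.
move=> x0; rewrite le_eqVlt => /predU1P[<-|v0].
  rewrite powR0 ?gt_eqF// mulr0 /frechet_intensity.
  rewrite [X in integral _ X _](_ : _ = set0) ?integral_set0//.
  by apply/seteqP; split => r //= []; rewrite mulr0 ltNge (ltW x0).
pose a := x / v; have a0 : 0 < a by exact: divr_gt0.
rewrite /frechet_intensity.
rewrite [X in integral _ X _](_ : _ = `]a, +oo[%classic); last first.
  apply/seteqP; split => r /=; rewrite !in_itv/= !andbT ltr_pdivrMr//.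
    by case.
  move=> xrv; split => //; rewrite -(pmulr_lgt0 _ v0); exact: lt_trans xrv.
rewrite integral_itv_obnd_cbnd//.
rewrite (@ge0_continuous_FTC2y _ (fun r => alpha * r `^ (- alpha - 1))
  (fun r => - r `^ (- alpha)) a 0).
- rewrite sub0e -EFinN opprK /a powRM ?invr_ge0 ?ltW//; congr (_ * _)%:E.
  by rewrite -powR_inv1 ?ltW// -powRrM mulN1r opprK.
- by move=> r _; rewrite mulr_ge0 ?powR_ge0 ?ltW.
- apply/continuous_within_itvcyP; split => [r|].
    rewrite in_itv/= andbT => ar; apply: cvgM; first exact: cvg_cst.
    by apply: continuous_powR_gt0; exact: lt_trans ar.
  apply: cvg_at_right_filter; apply: cvgM; first exact: cvg_cst.
  exact: continuous_powR_gt0.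
- by rewrite -[X in _ --> X]oppr0; apply: cvgN; exact: cvg_powRN_pinfty.
- move=> r ar; apply: derivableN; apply: derivable_powR.
  by rewrite in_itv/= andbT (lt_trans a0).
- by apply: cvg_at_right_filter; apply: cvgN; exact: continuous_powR_gt0.
- move=> r; rewrite in_itv/= andbT => ar.
  have r0 : 0 < r by exact: lt_trans ar.
  rewrite derive1E deriveN; last by apply: derivable_powR; rewrite in_itv/= r0.
  by rewrite -derive1E powR_derive1 ?in_itv/= ?r0// mulNr opprK.
Qed.

(** The bin collects the points that level v, but not level u, pushes beyond x. It is a difference
    of two tails, both finite since x > 0. *)
Lemma frechet_intensity_bin (x u v : R) : 0 < x -> 0 <= u -> u <= v ->
  frechet_intensity alpha [set r | r * u <= x < r * v] =
  (x `^ (- alpha) * (v `^ alpha - u `^ alpha))%:E.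
Proof.
move=> x0 u0 uv; have v0 := le_trans u0 uv.
have mC w : measurable [set r : R | x < r * w].
  have mw : measurable_fun [set: R] (fun r : R => r * w).
    by apply: measurable_funM.
  have := mw measurableT _ (measurable_itv `]x, +oo[); rewrite setTI.
  congr measurable; apply/seteqP.
  by split => r /=; rewrite in_itv/= andbT.
pose B := [set r : R | r * u <= x < r * v].
have CE : [set r | x < r * v] = B `|` [set r | x < r * u].
  apply/seteqP; split => r /=; rewrite /B/=.
    by move=> ->; rewrite andbT; case: leP => ?; [left|right].
  move=> [/andP[]//|xru].
  have r0 : 0 < r.
    rewrite ltNge; apply/negP => r0; move: xru.
    by apply/negP; rewrite -leNgt (le_trans _ (ltW x0))// mulr_le0_ge0.
  by apply: lt_le_trans xru _; rewrite ler_pM2l.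
have mB : measurable B.
  rewrite (_ : B = [set r | x < r * v] `\` [set r | x < r * u]).
    exact: measurableD.
  rewrite CE setDUl setDv setU0; apply/seteqP; split => r; last by case.
  by move=> /[dup] Br /andP[ru _]; split => //=; rewrite ltNge ru.
have := frechet_intensity_tail x0 v0.
rewrite CE {1}/frechet_intensity setIUl ge0_integral_setU//.
- rewrite -/(frechet_intensity alpha B).
  rewrite -/(frechet_intensity alpha [set r | x < r * u]).
  rewrite frechet_intensity_tail// => /esym/eqP.
  rewrite -sube_eq ?fin_num_adde_defl// => /eqP <-.
  by rewrite -EFinB mulrBr.
- by apply: measurableI; [exact: mB|exact: measurable_itv].
- by apply: measurableI; [exact: mC|exact: measurable_itv].
- exact: measurable_density.
- by move=> r _; exact: density_ge0.
- rewrite disj_set2E; apply/eqP; rewrite setIACA setIid.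
  by apply/seteqP; split => r //= [[/andP[ru _]] + _]; rewrite /= ltNge ru.
Qed.

End frechet_intensity.

(** * Averages over levels rewritten as products and increments over bins *)

Section level_sums.
Context (R : realType).
Implicit Types (q v a : nat -> R).

(** Since r * v k is nondecreasing in k, the levels passing the test form an initial segment. Either
    r lies in the single bin where the segment ends, or all levels pass and the sum is 1. The
    product form is the one that [poisson_pgf] accepts. *)
Lemma sum_level_indic q v (m : nat) (r x : R) :
  0 <= r -> 0 <= x -> v 0 = 0 -> {homo v : i j / (i <= j)%N >-> i <= j} ->
  \sum_(k < m.+1) q k = 1 ->
  \sum_(k < m.+1) q k * (r * v k <= x)%R%:R =
  \prod_(k < m) (\sum_(i < k.+1) q i) ^+ (r * v k <= x < r * v k.+1)%R.
Proof.
move=> r0 x0 v0 v_nd q1.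
pose S n := \sum_(k < n.+1) q k.
(* The induction cannot keep [q1]. Without it the case in which all levels pass is separate: there
   the product is 1 while the sum is S m. *)
have [rvm_prod sumE] :
    (r * v m <= x -> \prod_(k < m) S k ^+ (r * v k <= x < r * v k.+1)%R = 1) /\
    \sum_(k < m.+1) q k * (r * v k <= x)%R%:R = if r * v m <= x then S m else
      \prod_(k < m) S k ^+ (r * v k <= x < r * v k.+1)%R.
  elim: m {q1} => [|m [IH1 IH2]].
    by rewrite big_ord0 big_ord1 v0 mulr0 x0 mulr1 /S big_ord1.
  rewrite big_ord_recr/=.
  have [xv|vx] := leP (r * v m.+1) x.
    have vmx : r * v m <= x by rewrite (le_trans _ xv)// ler_wpM2l// v_nd.
    rewrite andbF expr0 mulr1 IH1//; split => //.
    by rewrite big_ord_recr/= IH2 vmx xv mulr1 /S [in RHS]big_ord_recr.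
  split => //; rewrite andbT big_ord_recr/= IH2 (leNgt (r * v m.+1)) vx mulr0 addr0.
  by have [vmx|] := leP (r * v m) x; rewrite ?mulr1// IH1// mul1r.
rewrite sumE; case: ifPn => // /rvm_prod ->.
by rewrite /S.
Qed.

(** Summation by parts: the factor 1 - \sum q is the probability that a mark exceeds k, so this is
    the tail formula for the mean of a. *)
Lemma sum_level_increments q a (m : nat) : a 0 = 0 -> \sum_(k < m.+1) q k = 1 ->
  \sum_(k < m) (a k.+1 - a k) * (1 - \sum_(i < k.+1) q i) =
  \sum_(k < m.+1) q k * a k.
Proof.
move=> a0 q1.
(* The boundary term, which vanishes under [q1], makes the identity true for all q and hence
   provable by induction. *)
suff -> : \sum_(k < m) (a k.+1 - a k) * (1 - \sum_(i < k.+1) q i) =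
    \sum_(k < m.+1) q k * a k + a m * (1 - \sum_(i < m.+1) q i).
  by rewrite q1 subrr mulr0 addr0.
elim: m {q1} => [|m IH]; first by rewrite big_ord0 big_ord1 a0 mulr0 mul0r addr0.
rewrite big_ord_recr/= IH [\sum_(k < m.+2) q k * _]big_ord_recr/=.
by rewrite [\sum_(k < m.+2) q k]big_ord_recr/=; ring.
Qed.

End level_sums.

(** The tuple is measurable when its domain carries the sigma-algebra generated by the process. *)
Lemma sigma_of_process_tuple d (T : measurableType d) (S : Type) (I : set S)
    dE (E : measurableType dE) (X : S -> T -> E) n (t : 'I_n -> S)
    (B : set (n.-tuple E)) : (forall i, I (t i)) -> measurable B ->
  sigma_of_process I X [set w | B [tuple X (t i) w | i < n]].
Proof.
move=> It mB.
pose Sigma := \bigcup_(s in I) g_sigma_algebra_preimage (X s).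
have mX : measurable_fun [set: g_sigma_algebraType Sigma]
    (fun w => [tuple X (t i) w | i < n]).
  apply/measurable_fun_tnthP => i.
  rewrite (_ : _ \o _ = X (t i)); last first.
    by apply/funext => w /=; rewrite tnth_mktuple.
  move=> _ Y mY; apply: sub_sigma_algebra.
  by exists (t i); [exact: It|exists Y].
by have := mX measurableT B mB; rewrite setTI.
Qed.

Section marked_poisson.
Context d (T : measurableType d) (R : realType) (P : probability T R).
Context (alpha : R) (alpha_gt0 : 0 < alpha) (G : nat -> T -> R).
Context (G_ge0 : forall i w, 0 <= G i w).
Context (G_poisson : poisson_point_process P (frechet_intensity alpha) G).
Context (F : option nat -> set (set T)) (F_indep : mutually_independent P F).
Context (FG : F None = sigma_of_process [set: nat] G).
Context (K : nat -> T -> nat) (FK : forall j k, F (Some j) [set w | K j w = k]).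
Context (mK : forall j k, measurable [set w | K j w = k]).

Lemma measurable_point_le j u x : measurable [set w | G j w * u <= x].
Proof.
have [mG _ _ _] := G_poisson.
have mGu : measurable_fun [set: T] (fun w => G j w * u).
  exact: measurable_funM.
by have := mGu measurableT _ (measurable_itv `]-oo, x]); rewrite setTI.
Qed.

Lemma measurable_marked_le (m n : nat) (v : nat -> R) (x : R) :
  (forall j w, (K j w < m.+1)%N) ->
  measurable [set w | forall j : 'I_n, G j w * v (K j w) <= x].
Proof.
move=> Km; rewrite [X in measurable X](_ : _ = \bigcap_(j in [set: 'I_n])
    \bigcup_(k in [set: 'I_m.+1])
      ([set w | K j w = k] `&` [set w | G j w * v k <= x])).
  apply: fin_bigcap_measurable => [|j _]; first exact: finite_finset.
  apply: fin_bigcup_measurable => [|k _]; first exact: finite_finset.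
  by apply: measurableI => //; exact: measurable_point_le.
apply/seteqP; split => w /= Ew.
  move=> j _; exists (Ordinal (Km j w)) => //.
  by split => //; exact: Ew.
by move=> j; have [k _ [/= -> ]] := Ew j I.
Qed.

(* Independence lets the marks be averaged out given the points: the
   conditional probability of the event is the product over the points of
   [g r = \sum_k q k * (r * v k <= x)], a step function of the point. *)
Lemma marked_poisson_finite (m : nat) (v q : nat -> R) (x : R) (n : nat) :
  (forall j w, (K j w < m.+1)%N) ->
  (forall j k, P [set w | K j w = k] = (q k)%:E) ->
  P [set w | forall j : 'I_n, G j w * v (K j w) <= x] =
  (\int[P]_w (\prod_(j < n) \sum_(k < m.+1)
     q k * (G j w * v k <= x)%R%:R)%R%:E)%E.
Proof.
move=> Km qE; have [mG _ _ _] := G_poisson.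
have q_ge0 k : 0 <= q k.
  by rewrite -lee_fin -(qE 0%N) measure_ge0.
pose A (j : 'I_n) (k : 'I_m.+1) :=
  [set w | K j w = k] `&` [set w | G j w * v k <= x].
have mA j k : measurable (A j k).
  by apply: measurableI => //; exact: measurable_point_le.
have mE := measurable_marked_le n v x Km.
transitivity (\int[P]_w (\prod_(j < n) \sum_(k < m.+1)
    1 * \1_(A j k) w)%R%:E)%E.
  have := integral_indic P measurableT mE; rewrite setIT => <-.
  apply: eq_integral => w _.
  congr EFin; rewrite indicE.
  have termE j : \sum_(k < m.+1) 1 * \1_(A j k) w =
      (G j w * v (K j w) <= x)%R%:R :> R.
    rewrite (bigD1 (Ordinal (Km j w)))//= big1 => [|k kK].
      rewrite addr0 mul1r indicE; congr (nat_of_bool _)%:R.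
      by apply/idP/idP => [/set_mem[]//|Gx]; exact: mem_set.
    rewrite mul1r indicE memNset// => -[/= Kk _].
    by move: kK; rewrite -val_eqE/= Kk eqxx.
  under eq_bigr do rewrite termE.
  case: (asboolP (forall j : 'I_n, G j w * v (K j w) <= x)) => /= Ew.
    by rewrite mem_set// big1// => j _; rewrite Ew.
  rewrite memNset//; have /existsNP[j /negP Ej] := Ew.
  by rewrite (bigD1 j)//= (negbTE Ej) mul0r.
rewrite integral_prod_sum_indic//.
transitivity (\int[P]_w (\prod_(j < n) \sum_(k < m.+1)
    q k * \1_[set w | (G j w * v k <= x)%R] w)%R%:E)%E; last first.
  apply: eq_integral => w _; congr EFin; apply: eq_bigr => j _.
  apply: eq_bigr => k _; congr (_ * _); rewrite indicE; congr (nat_of_bool _)%:R.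
  by apply/idP/idP => [/set_mem//|Gx]; exact: mem_set.
rewrite integral_prod_sum_indic//; last by move=> j k; exact: measurable_point_le.
apply: eq_bigr => f _.
rewrite big1// mul1e.
(* For a fixed choice f of marks, all conditions on the points form one event of the sigma-algebra
   of G, listed under None, next to one mark event per point. Independence then splits off the
   factors q. *)
pose C (o : option 'I_n) := if o is Some j then [set w | K j w = f j]
  else \bigcap_(j in [set: 'I_n]) [set w | G j w * v (f j) <= x].
have FC o : F (omap val o) (C o).
  case: o => [j|]; rewrite /C/=; first exact: FK.
  rewrite FG.
  rewrite [X in sigma_of_process _ _ X](_ : _ = [set w |
    (\bigcap_(j in [set: 'I_n]) [set s : n.-tuple R | tnth s j * v (f j) <= x])
      [tuple G (val i) w | i < n]]).
    apply: (@sigma_of_process_tuple _ _ _ _ _ _ _ _ (fun i : 'I_n => val i)) => //.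
    apply: fin_bigcap_measurable => [|j _]; first exact: finite_finset.
    have mt : measurable_fun [set: n.-tuple R] (fun s => tnth s j * v (f j)).
      by apply: measurable_funM => //; exact: measurable_tnth.
    by have := mt measurableT _ (measurable_itv `]-oo, x]); rewrite setTI.
  by apply/seteqP; split => w /= Gw j _; have := Gw j I; rewrite /= tnth_mktuple.
have val_inj' : injective (omap val : option 'I_n -> option nat).
  by move=> [i|] [j|] //= [] /val_inj ->.
transitivity (P (\bigcap_(o in [set: option 'I_n]) C o)).
  congr (P _); apply/seteqP; split => w /= Aw.
    by move=> [j|] _ /=; [case: (Aw j I)|move=> j _; case: (Aw j I)].
  by move=> j _; split; [exact: (Aw (Some j) I)|exact: (Aw None I j I)].
rewrite (mutually_independent_bigcap F_indep val_inj' FC).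
rewrite (bigD1 None)//= muleC; congr (_ * _)%E.
rewrite (reindex_omap Some id)/=; last by case.
rewrite (eq_bigl predT) => [|j]; last by rewrite /= eqxx.
by rewrite -prodEFin; apply: eq_bigr => j _; exact: qE.
Qed.

(** By [sum_level_indic] a point in bin k contributes the factor p k and a point in no bin
    contributes 1. The generating function and [sum_level_increments] then give the exponent. Level
    0 being 0, every point passes the lowest level, and those too small for the top level fall in no
    bin. *)
Lemma marked_poisson_max (m : nat) (v q : nat -> R) (x : R) : 0 < x ->
  (forall j w, (K j w < m.+1)%N) ->
  (forall j k, P [set w | K j w = k] = (q k)%:E) ->
  v 0 = 0 -> {homo v : i j / (i <= j)%N >-> i <= j} ->
  P [set w | forall j, G j w * v (K j w) <= x] =
  (expR (- (x `^ (- alpha) * \sum_(k < m.+1) q k * v k `^ alpha)))%:E.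
Proof.
move=> x0 Km qE v0 v_nd; have [mG _ _ _] := G_poisson.
have v_ge0 k : 0 <= v k by rewrite -v0; exact: v_nd.
have q_ge0 k : 0 <= q k.
  by rewrite -lee_fin -(qE 0%N) measure_ge0.
have q1 : \sum_(k < m.+1) q k = 1.
  apply: EFin_inj; rewrite -sumEFin.
  have <- : P setT = 1%E by exact: probability_setT.
  have -> : [set: T] = \bigcup_(k in `I_m.+1) [set w | K 0%N w = k].
    by apply/esym; rewrite -subTset => w _; exists (K 0%N w) => //=; exact: Km.
  have := measure_semi_additive_ord_I P (F := fun k => [set w | K 0%N w = k])
    (n := m.+1).
  rewrite bigcup_mkord => ->//.
  - by apply: eq_bigr => k _; exact/esym/qE.
  - by move=> i j _ _ [w [/= -> ->]].
  - exact: bigsetU_measurable.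
(* The probability that a mark is at most k, that is, that a point of bin k stays below x. *)
pose p k := \sum_(i < k.+1) q i.
have p01 (k : 'I_m) : 0 <= p k <= 1.
  rewrite /p sumr_ge0//= -q1 -(big_mkord predT q) -[leRHS](big_mkord predT q).
  have km : (k.+1 <= m.+1)%N by rewrite ltnS ltnW.
  by rewrite [leRHS](big_cat_nat (leq0n k.+1) km)/= lerDl sumr_ge0.
pose B k := if (k < m)%N then [set r | r * v k <= x < r * v k.+1] else set0.
have mB k : measurable (B k).
  rewrite /B; case: ifP => // _.
  have mv u : measurable_fun [set: R] (fun r : R => r * u).
    exact: measurable_funM.
  have m1 := mv (v k) measurableT _ (measurable_itv `]-oo, x]).
  have m2 := mv (v k.+1) measurableT _ (measurable_itv `]x, +oo[).
  have := measurableI _ _ m1 m2; rewrite !setTI.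
  congr measurable; apply/seteqP.
  by split => r /=; rewrite !in_itv/= andbT => /andP.
have tB : trivIset setT B.
  apply: ltn_trivIset => k l kl; apply/seteqP; split => // r [].
  rewrite /B; case: ifP => // _; case: ifP => // _ /= /andP[_ xr] /andP[rx _].
  have r0 : 0 < r.
    rewrite ltNge; apply/negP => r0; move: xr.
    by apply/negP; rewrite -leNgt (le_trans _ (ltW x0))// mulr_le0_ge0.
  move: xr; apply/negP; rewrite -leNgt (le_trans _ rx)//.
  by rewrite ler_pM2l// v_nd.
have LB k : (k < m)%N -> frechet_intensity alpha (B k) =
    (x `^ (- alpha) * (v k.+1 `^ alpha - v k `^ alpha))%:E.
  by move=> km; rewrite /B km frechet_intensity_bin// v_nd.
have /= cvg_pgf := poisson_pgf G_poisson mB tB _ p01.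
have {}cvg_pgf := cvg_pgf (fun k km =>
  eq_ind_r (fun z => z < +oo)%E (ltry _) (LB k km)).
rewrite [RHS](_ : _ =
    (\prod_(k < m) expR (- fine (frechet_intensity alpha (B k)) * (1 - p k)))%:E);
  last first.
  rewrite -expR_sum; congr (expR _)%:E.
  rewrite -(@sum_level_increments _ q (fun k => v k `^ alpha) m)//; last first.
    by rewrite v0 powR0// gt_eqF.
  rewrite mulr_sumr -sumrN; apply: eq_bigr => k _.
  by rewrite LB//= mulNr mulrA.
pose E n := [set w | forall j : 'I_n, G j w * v (K j w) <= x].
have -> : [set w | forall j, G j w * v (K j w) <= x] = \bigcap_n E n.
  apply/seteqP; split => w /= Ew; first by move=> n _ j; exact: Ew.
  by move=> j; exact: (Ew j.+1 I ord_max).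
have mE n : measurable (E n) by exact: measurable_marked_le.
have cvgE : (P (E n) @[n --> \oo] --> P (\bigcap_n E n))%E.
  apply: nonincreasing_cvg_mu => //.
  - by rewrite (le_lt_trans (probability_le1 _ _)) ?ltry.
  - exact: bigcapT_measurable.
  - move=> i j ij; apply/subsetPset => w Ew k.
    exact: (Ew (widen_ord ij k)).
apply: (cvg_unique _ cvgE) => //.
apply: cvg_trans cvg_pgf; apply: near_eq_cvg; apply: nearW => n.
rewrite /E (marked_poisson_finite v x n Km qE).
apply: eq_integral => w _; congr EFin.
apply: eq_bigr => j _; rewrite sum_level_indic// ?ltW//.
apply: eq_bigr => k _; congr (_ ^+ _); congr nat_of_bool.
by rewrite /B ltn_ord; apply/idP/idP => [/set_mem|/mem_set].
Qed.

End marked_poisson.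

(** * The law of suprema in the de Haan representation *)

Section dyadic_truncation.
Context (R : realType).
Implicit Types (x y : R) (n k : nat).

(** Rounding down to mesh 2 ^ (- n), capped at height n: the range is finite, as
    [marked_poisson_max] requires, and negative y have index 0. *)
Definition dyadic_index n y : nat :=
  minn (Num.truncn (2 ^+ n * y)) (n * 2 ^ n).

Definition dyadic_level n k : R := k%:R / 2 ^+ n.

Definition dyadic_trunc n y : R := dyadic_level n (dyadic_index n y).

Lemma dyadic_index_lt n y : (dyadic_index n y < (n * 2 ^ n).+1)%N.
Proof. by rewrite ltnS geq_minr. Qed.

Lemma dyadic_level_nd n : {homo dyadic_level n : i j / (i <= j)%N >-> i <= j}.
Proof. by move=> i j ij; rewrite ler_pM2r ?invr_gt0 ?exprn_gt0// ler_nat. Qed.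

Lemma dyadic_trunc_ge0 n y : 0 <= dyadic_trunc n y.
Proof. by rewrite divr_ge0// exprn_ge0. Qed.

Lemma dyadic_trunc_le n y : 0 <= y -> dyadic_trunc n y <= y.
Proof.
move=> y0; rewrite ler_pdivrMr ?exprn_gt0//.
apply: (@le_trans _ _ (Num.truncn (2 ^+ n * y))%:R).
  by rewrite ler_nat geq_minl.
by rewrite [leRHS]mulrC truncn_le mulr_ge0// exprn_ge0.
Qed.

(** Halving the mesh doubles the index of a level, and doubling a floor or a cap never exceeds the
    floor or the cap of the next stage. *)
Lemma le_dyadic_trunc m n x y : (m <= n)%N -> x <= y ->
  dyadic_trunc m x <= dyadic_trunc n y.
Proof.
move=> mn xy; apply: (@le_trans _ _ (dyadic_trunc m y)).
  apply: dyadic_level_nd; rewrite leq_min geq_minr andbT.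
  rewrite (leq_trans (geq_minl _ _))// le_truncn//.
  by rewrite ler_wpM2l// exprn_ge0.
elim: n mn => [|n IH]; first by rewrite leqn0 => /eqP ->.
rewrite leq_eqVlt => /predU1P[-> //|/IH /le_trans]; apply.
rewrite ler_pdivrMr ?exprn_gt0// mulrAC exprS.
rewrite ler_pdivlMr ?mulr_gt0 ?exprn_gt0// mulrA ler_pM2r ?exprn_gt0//.
rewrite -natrM ler_nat /dyadic_index leq_min.
have [y0|y0] := leP 0 y; last first.
  rewrite (_ : Num.truncn (2 ^+ n * y) = 0%N) ?min0n//.
  apply/truncn0Pn; rewrite -ltNge (@le_lt_trans _ _ 0)//.
  by rewrite mulr_ge0_le0 ?exprn_ge0 ?ltW.
have y2 : 0 <= 2 ^+ n * y by rewrite mulr_ge0// exprn_ge0.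
apply/andP; split.
  rewrite truncn_ge_nat; last by rewrite exprS -mulrA mulr_ge0.
  rewrite natrM mulrC exprS -mulrA ler_pM2l//.
  rewrite (@le_trans _ _ (Num.truncn (2 ^+ n * y))%:R)//.
    by rewrite ler_nat geq_minl.
  by rewrite truncn_le.
rewrite expnS mulnCA mulnC leq_pmul2l//.
by rewrite (leq_trans (geq_minr _ _))// leq_pmul2r ?expn_gt0.
Qed.

(** If c < y, choose n above y, so that the cap is inactive, and with 2 ^ (- n) < y - c, so that
    rounding cannot fall to c. Only n > i is considered because coordinate i enters the maximum of
    the first n coordinates only then. *)
Lemma dyadic_trunc_dense y c i :
  (forall n, (i < n)%N -> dyadic_trunc n y <= c) -> y <= c.
Proof.
move=> yc; rewrite leNgt; apply/negP => cy.
have c0 : 0 <= c by apply: le_trans (yc i.+1 _); rewrite ?dyadic_trunc_ge0.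
have y0 : 0 <= y by rewrite (le_trans c0)// ltW.
have [n [i_n y_n yc_n]] : exists n, [/\ (i < n)%N,
    (Num.truncn y < n)%N & (Num.truncn (y - c)^-1 < n)%N].
  exists (maxn i.+1 (maxn (Num.truncn y).+1 (Num.truncn (y - c)^-1).+1)).
  by split; rewrite !leq_max leqnn ?orbT.
have yn : y <= n%:R.
  by apply/ltW/(lt_le_trans (truncnS_gt y)); rewrite ler_nat.
have ycn : (y - c)^-1 < 2 ^+ n.
  apply: (lt_trans (truncnS_gt _)); rewrite -natrX ltr_nat.
  by apply: leq_ltn_trans yc_n _; rewrite ltn_expl.
have := yc n i_n; apply/negP; rewrite -ltNge.
have y2 : 0 <= 2 ^+ n * y by rewrite mulr_ge0// exprn_ge0.
rewrite /dyadic_trunc /dyadic_index (minn_idPl _); last first.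
  rewrite -ltnS truncn_lt_nat// (@le_lt_trans _ _ (n * 2 ^ n)%:R) ?ltr_nat//.
  by rewrite natrM natrX mulrC ler_pM2r ?exprn_gt0.
rewrite ltr_pdivlMr ?exprn_gt0//.
have /andP[_] := truncn_itv y2.
rewrite -(natr1 (Num.truncn (2 ^+ n * y))) -ltrBlDr; apply: le_lt_trans.
rewrite lerBrDr -lerBrDl [2 ^+ n * y]mulrC -mulrBl.
rewrite -ler_pdivrMl ?subr_gt0// mulr1.
exact: ltW.
Qed.

Lemma measurable_dyadic_index n k : measurable [set y | dyadic_index n y = k].
Proof.
have mge l : measurable [set y | (l <= dyadic_index n y)%N].
  have [ln|nl] := leqP l (n * 2 ^ n); last first.
    rewrite [X in measurable X](_ : _ = set0) ?measurable0//.
    apply/seteqP; split => // y /=; rewrite leq_min => /andP[_].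
    by rewrite leqNgt nl.
  case: l ln => [_|l ln].
    by rewrite [X in measurable X](_ : _ = setT)//; apply/seteqP; split.
  rewrite [X in measurable X](_ : _ = `[l.+1%:R / 2 ^+ n, +oo[%classic)//.
  apply/seteqP; split => y /=; rewrite in_itv/= andbT leq_min ln andbT truncn_gt_nat.
    by rewrite ler_pdivrMr ?exprn_gt0// mulrC.
  by rewrite ler_pdivrMr ?exprn_gt0// mulrC.
rewrite [X in measurable X](_ : _ = [set y | (k <= dyadic_index n y)%N] `\`
    [set y | (k.+1 <= dyadic_index n y)%N]); first exact: measurableD.
apply/seteqP; split => y /=; first by move=> ->; rewrite leqnn ltnn.
by move=> [? /negP]; rewrite -leqNgt => ?; apply/eqP; rewrite eqn_leq; apply/andP.
Qed.

End dyadic_truncation.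

Section convergence_tools.
Context (R : realType).

(** The value h = +oo is allowed because the law of the suprema is established before the moment is
    known to be finite. *)
Lemma cvg_expeRN (u : R^nat) (c : R) (h : \bar R) : 0 < c -> (0 <= h)%E ->
  ((u n)%:E @[n --> \oo] --> h)%E ->
  ((expR (- (c * u n)))%:E @[n --> \oo] --> expeR (- (c%:E * h)))%E.
Proof.
move=> c0; case: h => [h _|_|//] uh.
  rewrite /=; apply: cvg_EFin; first exact: nearW.
  apply: continuous_cvg; first exact: continuous_expR.
  by apply: cvgN; apply: cvgMl_tmp; exact: (fine_cvg uh).
rewrite gt0_muley ?lte_fin//=; apply: cvg_EFin; first exact: nearW.
have cu : c * u n @[n --> \oo] --> +oo%R.
  move/cvgeryP/cvgryPge : uh => uh; apply/cvgryPge => A.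
  by apply: filterS (uh (A / c)) => n; rewrite ler_pdivrMr// mulrC.
exact: (cvg_comp _ _ cu (@cvgr_expR R)).
Qed.

Lemma powR_le (a z r : R) : 0 < a -> 0 <= z -> 0 <= r ->
  (z `^ a <= r) = (z <= r `^ a^-1).
Proof.
move=> a0 z0 r0; rewrite -{1}[r](powRr1 r0) -[1](@mulVf _ a) ?gt_eqF// powRrM.
apply/idP/idP => [|zr]; last by rewrite ge0_ler_powR ?nnegrE ?powR_ge0 ?(ltW a0).
by apply: contraTT; rewrite -!ltNge => ?; rewrite gt0_ltr_powR ?nnegrE ?powR_ge0.
Qed.

Lemma measurable_bigmax_tuple n :
  measurable_fun [set: n.-tuple R] (fun s => \big[Num.max/0]_(i < n) tnth s i).
Proof.
elim: (index_enum _) => [|i r IH].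
  by under eq_fun do rewrite big_nil; exact: measurable_cst.
under eq_fun do rewrite big_cons.
by apply: measurable_maxr => //; exact: measurable_tnth.
Qed.

End convergence_tools.

Lemma measurable_process_tuple (R : realType) (I : set R) d
    (T : measurableType d) dE (E : measurableType dE) (X : R -> T -> E)
    n (t : 'I_n -> R) : stochastic_process I X -> (forall i, I (t i)) ->
  measurable_fun [set: T] (fun w => [tuple X (t i) w | i < n]).
Proof.
move=> mX It; apply/measurable_fun_tnthP => i.
rewrite (_ : _ \o _ = X (t i)); first exact: mX.
by apply/funext => w /=; rewrite tnth_mktuple.
Qed.

Section finite_maxima.
Context (R : realType).
Implicit Types (f : nat -> R) (n : nat).

(** Starting at 0 discards negative values. The copies [W j] share only the finite-dimensional laws
    of Z and may be negative somewhere, but there the inequality G * W <= x holds anyway, as x >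
    0. *)
Definition maxn0 f n : R := \big[Num.max/0]_(i < n) f i.

Lemma maxn0_ge0 f n : 0 <= maxn0 f n.
Proof. exact: bigmax_ge_id. Qed.

Lemma maxn0_ge f i n : (i < n)%N -> f i <= maxn0 f n.
Proof. by move=> i_n; exact: (le_bigmax _ (fun j : 'I_n => f j) (Ordinal i_n)). Qed.

Lemma le_maxn0 f m n : (m <= n)%N -> maxn0 f m <= maxn0 f n.
Proof.
move=> mn; apply: bigmax_le => [|i _]; first exact: maxn0_ge0.
by apply: maxn0_ge; exact: leq_trans mn.
Qed.

Lemma maxn0_le f n y : 0 <= y -> (forall i, f i <= y) -> maxn0 f n <= y.
Proof. by move=> y0 fy; exact: bigmax_le. Qed.

(** One index n drives both the number of coordinates and the mesh. Nothing is lost, since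
    coordinate i is seen by every n > i. *)
Lemma ereal_sup_dyadic_maxn0 (a : R) f : 0 < a -> (forall i, 0 <= f i) ->
  ereal_sup (range (fun n => (dyadic_trunc n (maxn0 f n) `^ a)%:E)) =
  ereal_sup (range (fun i => (f i `^ a)%:E)).
Proof.
move=> a0 f0; apply/eqP; rewrite eq_le; apply/andP; split.
  apply: ge_ereal_sup => _ [n _ <-].
  set s := ereal_sup _.
  have fs i : ((f i `^ a)%:E <= s)%E by apply: ereal_sup_ubound; exists i.
  case: s fs => [s fs||fs]; [|by rewrite leey|by have := fs 0%N].
  have s0 : 0 <= s.
    by rewrite -lee_fin; apply: le_trans (fs 0%N); rewrite lee_fin powR_ge0.
  rewrite lee_fin powR_le ?dyadic_trunc_ge0//.
  rewrite (le_trans (dyadic_trunc_le _ (maxn0_ge0 _ _)))//.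
  by apply: maxn0_le => [|i]; rewrite ?powR_ge0// -powR_le// -lee_fin.
apply: ge_ereal_sup => _ [i _ <-].
set s := ereal_sup _.
have fs n : ((dyadic_trunc n (maxn0 f n) `^ a)%:E <= s)%E.
  by apply: ereal_sup_ubound; exists n.
case: s fs => [s fs||fs]; [|by rewrite leey|by have := fs 0%N].
have s0 : 0 <= s.
    by rewrite -lee_fin; apply: le_trans (fs 0%N); rewrite lee_fin powR_ge0.
rewrite lee_fin powR_le//; apply: (@dyadic_trunc_dense _ _ _ i) => n i_n.
rewrite (le_trans (le_dyadic_trunc (leqnn n) (maxn0_ge f i_n)))//.
by rewrite -powR_le ?dyadic_trunc_ge0// -lee_fin.
Qed.

End finite_maxima.

Section spectral_law.
Context (R : realType) (alpha : R) (alpha_gt0 : 0 < alpha) (I : set R).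
Context d' (O' : measurableType d') (P' : probability O' R) (Z : R -> O' -> R).
Context dQ (OQ : measurableType dQ) (Q : probability OQ R).
Context (G : nat -> OQ -> R) (W : nat -> R -> OQ -> R).
Context (mZ : stochastic_process I Z) (Z_ge0 : forall t w, I t -> 0 <= Z t w).
Context (G_ge0 : forall i w, 0 <= G i w).
Context (G_poisson : poisson_point_process Q (frechet_intensity alpha) G).
Context (mW : forall i, stochastic_process I (W i)).
Context (WZ : forall i, eq_fdd I Q (W i) P' Z).
Context (GW_indep : mutually_independent Q (fun k : option nat =>
  if k is Some i then sigma_of_process I (W i)
  else sigma_of_process [set: nat] G)).
Context (t : nat -> R) (It : forall i, I (t i)) (x : R) (x_gt0 : 0 < x).

(** At stage n the mark of point j is computed from its copy at the first n times. [K'] is the same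
    functional of Z, so both have law [q n], and [a n] is the alpha-th moment of the truncated
    maximum of Z. *)
Let K n j w := dyadic_index n (maxn0 (fun i => W j (t i) w) n).
Let K' n w := dyadic_index n (maxn0 (fun i => Z (t i) w) n).
Let q n k := fine (P' [set w | K' n w = k]).
Let a n := \sum_(k < (n * 2 ^ n).+1) q n k * dyadic_level R n k `^ alpha.

(** Mark events written as Borel sets of n-tuples, the form in which equality of laws and
    independence can be applied to them. *)
Let S n k : set (n.-tuple R) := [set s |
  dyadic_index n (\big[Num.max/0]_(i < n) tnth s i) = k].

Let mS n k : measurable (@S n k).
Proof.
have := @measurable_bigmax_tuple R n measurableT _ (measurable_dyadic_index n k).
by rewrite setTI.
Qed.

Let KE n j k :
  [set w | K n j w = k] = [set w | @S n k [tuple W j (t i) w | i < n]].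
Proof.
apply/funext => w /=; rewrite /S/= /K /maxn0.
by under [in RHS]eq_bigr do rewrite tnth_mktuple.
Qed.

Let K'E n k : [set w | K' n w = k] = [set w | @S n k [tuple Z (t i) w | i < n]].
Proof.
apply/funext => w /=; rewrite /S/= /K' /maxn0.
by under [in RHS]eq_bigr do rewrite tnth_mktuple.
Qed.

Let mK n j k : measurable [set w | K n j w = k].
Proof.
rewrite KE; have := @measurable_process_tuple R I _ _ _ _ (W j) n
  (fun i => t i) (mW j) (fun i => It i) measurableT _ (mS k).
by rewrite setTI.
Qed.

Let mK' n k : measurable [set w | K' n w = k].
Proof.
rewrite K'E; have := @measurable_process_tuple R I _ _ _ _ Z n
  (fun i => t i) mZ (fun i => It i) measurableT _ (mS k).
by rewrite setTI.
Qed.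

Let P'K' n k : P' [set w | K' n w = k] = (q n k)%:E.
Proof. by rewrite /q fineK// fin_num_measure. Qed.

Let QK n j k : Q [set w | K n j w = k] = (q n k)%:E.
Proof.
rewrite -P'K' KE K'E.
exact: (WZ j (t := fun i : 'I_n => t i) (fun i => It i) (mS k)).
Qed.

Let E n := [set w | forall j, G j w * dyadic_level R n (K n j w) <= x].

Let QE n : Q (E n) = (expR (- (x `^ (- alpha) * a n)))%:E.
Proof.
apply: (marked_poisson_max alpha_gt0 G_ge0 G_poisson GW_indep) => //.
- move=> j k; rewrite KE; apply: sigma_of_process_tuple => //.
- by move=> j w; exact: dyadic_index_lt.
- by rewrite /dyadic_level mul0r.
- exact: dyadic_level_nd.
Qed.

Let mE n : measurable (E n).
Proof.
rewrite [E n](_ : _ = \bigcap_j [set w | G j w * dyadic_level R n (K n j w) <= x]).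
  apply: bigcapT_measurable => j.
  rewrite [X in measurable X](_ : _ = \bigcup_k ([set w | K n j w = k] `&`
      [set w | G j w * dyadic_level R n k <= x])).
    apply: bigcupT_measurable => k; apply: measurableI => //.
    exact: (measurable_point_le G_poisson).
  apply/seteqP; split => w /=; first by move=> Gx; exists (K n j w).
  by move=> [k _ [<-]].
by apply/seteqP; split => w /= Ew // j; [move=> _|]; exact: Ew.
Qed.

Let dyadicE n w : dyadic_trunc n (maxn0 (fun i => Z (t i) w) n) `^ alpha =
  \sum_(k < (n * 2 ^ n).+1)
    dyadic_level R n k `^ alpha * \1_[set w | K' n w = k] w.
Proof.
have Kn := dyadic_index_lt n (maxn0 (fun i => Z (t i) w) n).
rewrite (bigD1 (Ordinal Kn))//= big1 ?addr0 => [|k kK].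
  by rewrite indicE mem_set// mulr1.
rewrite indicE memNset ?mulr0//= => K'k.
by move: kK; rewrite -val_eqE/= -K'k eqxx.
Qed.

Let integral_dyadic n :
  (\int[P']_w (dyadic_trunc n (maxn0 (fun i => Z (t i) w) n) `^ alpha)%:E =
   (a n)%:E)%E.
Proof.
transitivity (\int[P']_w \sum_(k < (n * 2 ^ n).+1)
    (dyadic_level R n k `^ alpha)%:E * (\1_[set w | K' n w = k] w)%:E)%E.
  by apply: eq_integral => w _; rewrite dyadicE -sumEFin.
rewrite ge0_integral_sum//.
- rewrite /a -sumEFin; apply: eq_bigr => k _.
  rewrite ge0_integralZl ?lee_fin ?powR_ge0//.
  + rewrite integral_indic// setIT [RHS]EFinM [RHS]muleC; congr (_ * _)%E.
    exact: P'K'.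
  + by apply/measurable_EFinP; exact: measurable_indic.
- move=> k; apply: measurable_funeM.
  by apply/measurable_EFinP; exact: measurable_indic.
- by move=> k w _; rewrite -EFinM lee_fin mulr_ge0// powR_ge0.
Qed.

Let dyadic_nd m n (f : nat -> R) : (m <= n)%N ->
  dyadic_trunc m (maxn0 f m) <= dyadic_trunc n (maxn0 f n).
Proof. by move=> mn; apply: le_dyadic_trunc => //; exact: le_maxn0. Qed.

(* The maxima of the first n coordinates, truncated to dyadic levels, take
   finitely many values and increase to the supremum, so a single monotone limit
   reduces the claim to marked_poisson_max. *)
Lemma spectral_sup_law : Q [set w | forall j i, G j w * W j (t i) w <= x] =
  expeR (- ((x `^ (- alpha))%:E *
    \int[P']_w ereal_sup (range (fun i => (Z (t i) w `^ alpha)%:E)))).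
Proof.
(* A point at 0 meets both conditions. For any other, division by G turns each condition into a
   bound on the copy, and [dyadic_trunc_dense] recovers the values from the truncated maxima. *)
have -> : [set w | forall j i, G j w * W j (t i) w <= x] = \bigcap_n E n.
  apply/seteqP; split => w /= Gx.
    move=> n _ j.
    have := G_ge0 j w; rewrite le_eqVlt => /predU1P[<-|Gj0].
      by rewrite mul0r ltW.
    rewrite mulrC -ler_pdivlMr//.
    rewrite (le_trans (dyadic_trunc_le _ (maxn0_ge0 _ _)))//.
    apply: maxn0_le => [|i]; first by rewrite divr_ge0 ?ltW.
    by rewrite ler_pdivlMr// mulrC.
  move=> j i; have := G_ge0 j w; rewrite le_eqVlt => /predU1P[<-|Gj0].
    by rewrite mul0r ltW.
  rewrite mulrC -ler_pdivlMr//; apply: (@dyadic_trunc_dense _ _ _ i) => n i_n.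
  apply: (le_trans (le_dyadic_trunc (leqnn n)
    (maxn0_ge (fun i => W j (t i) w) i_n))).
  by rewrite ler_pdivlMr// mulrC; exact: Gx.
have cvgE : (Q (E n) @[n --> \oo] --> Q (\bigcap_n E n))%E.
  apply: nonincreasing_cvg_mu => //.
  - by rewrite (le_lt_trans (probability_le1 _ _)) ?ltry.
  - exact: bigcapT_measurable.
  - move=> m n mn; apply/subsetPset => w Ew j.
    by rewrite (le_trans _ (Ew j))// ler_wpM2l// dyadic_nd.
apply: (cvg_unique _ cvgE) => //.
rewrite (_ : (fun n => _) =
    fun n => (expR (- (x `^ (- alpha) * a n)))%:E); last first.
  by apply/funext => n; exact: QE.
apply: cvg_expeRN; first exact: powR_gt0.
  apply: integral_ge0 => w _.
  apply: (@le_trans _ _ (Z (t 0%N) w `^ alpha)%:E).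
    by rewrite lee_fin powR_ge0.
  by apply: ereal_sup_ubound; exists 0%N.
have -> : (\int[P']_w ereal_sup (range (fun i => (Z (t i) w `^ alpha)%:E)) =
    \int[P']_w limn (fun n =>
      (dyadic_trunc n (maxn0 (fun i => Z (t i) w) n) `^ alpha)%:E))%E.
  apply: eq_integral => w _; rewrite -ereal_sup_dyadic_maxn0//; last first.
    by move=> i; exact: Z_ge0.
  apply/esym/cvg_lim => //; apply: ereal_nondecreasing_cvgn => m n mn.
  rewrite lee_fin ge0_ler_powR ?nnegrE ?dyadic_trunc_ge0 ?(ltW alpha_gt0)//.
  exact: dyadic_nd.
rewrite (_ : (fun n => _) = fun n => \int[P']_w
    (dyadic_trunc n (maxn0 (fun i => Z (t i) w) n) `^ alpha)%:E)%E; last first.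
  by apply/funext => n; rewrite integral_dyadic.
apply: cvg_monotone_convergence => //.
- move=> n; apply/measurable_EFinP.
  under eq_fun do rewrite dyadicE.
  by apply: measurable_sum => k; apply: measurable_funM.
- by move=> n w _; rewrite lee_fin powR_ge0.
- move=> w _ m n mn.
  rewrite lee_fin ge0_ler_powR ?nnegrE ?dyadic_trunc_ge0 ?(ltW alpha_gt0)//.
  exact: dyadic_nd.
Qed.

End spectral_law.

(** * Suprema of X over sequences of times *)

Section countable_intersections.
Context (R : realType).

(** Both sides are decreasing limits over the first n events, so equality of finite-dimensional laws
    extends to countably many times. *)
Lemma eq_probability_forall d1 (T1 : measurableType d1)
    (P1 : probability T1 R) (A : nat -> set T1)
    d2 (T2 : measurableType d2) (P2 : probability T2 R) (B : nat -> set T2) :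
  (forall i, measurable (A i)) -> (forall i, measurable (B i)) ->
  (forall n, P1 [set w | forall i : 'I_n, A i w] =
             P2 [set w | forall i : 'I_n, B i w]) ->
  P1 [set w | forall i, A i w] = P2 [set w | forall i, B i w].
Proof.
have cvg d (T : measurableType d) (P : probability T R) (C : nat -> set T) :
    (forall i, measurable (C i)) ->
    (P [set w | forall i : 'I_n, C i w] @[n --> \oo] -->
     P [set w | forall i, C i w])%E.
  move=> mC.
  have mCn n : measurable [set w | forall i : 'I_n, C i w].
    rewrite [X in measurable X](_ : _ = \bigcap_(i in [set: 'I_n]) C i).
      by apply: fin_bigcap_measurable => //; exact: finite_finset.
    by apply/seteqP; split => w /= Cw i => [_|]; exact: Cw.
  have CE : [set w | forall i, C i w] =
      \bigcap_n [set w | forall i : 'I_n, C i w].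
    apply/seteqP; split => w /= Cw; first by move=> n _ i; exact: Cw.
    by move=> i; exact: (Cw i.+1 Logic.I ord_max).
  rewrite CE; apply: nonincreasing_cvg_mu => //.
  - by rewrite (le_lt_trans (probability_le1 _ _)) ?ltry.
  - exact: bigcapT_measurable.
  - move=> m n mn; apply/subsetPset => w Cw i.
    exact: (Cw (widen_ord mn i)).
move=> mA mB AB.
apply: (cvg_unique _ (cvg _ _ P1 A mA)) => //.
rewrite (_ : (fun n => _) = fun n => P2 [set w | forall i : 'I_n, B i w]).
  exact: cvg.
by apply/funext => n; exact: AB.
Qed.

Lemma measurable_process_le (I : set R) d (T : measurableType d)
    (X : R -> T -> R) (t x : R) : stochastic_process I X -> I t ->
  measurable [set w | X t w <= x].
Proof.
move=> mX It; have := mX t It measurableT _ (measurable_itv `]-oo, x]).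
by rewrite setTI.
Qed.

End countable_intersections.

Section law_of_countable_suprema.
Context (R : realType) (alpha : R) (alpha_gt0 : 0 < alpha) (I : set R).
Context d (Omega : measurableType d) (P : probability Omega R).
Context d' (Omega' : measurableType d') (P' : probability Omega' R).
Context (X : R -> Omega -> R) (Z : R -> Omega' -> R).
Context (X_process : stochastic_process I X).
Context (X_spectral : spectral_process I alpha P X P' Z).

(** The countable counterpart of H(T): its integrand is a supremum of a sequence, and the law of X
    determines its value. *)
Definition sup_moment (t : nat -> R) : \bar R :=
  \int[P']_w ereal_sup (range (fun i => (Z (t i) w `^ alpha)%:E)).

Lemma countable_sup_law (t : nat -> R) (x : R) : (forall i, I (t i)) -> 0 < x ->
  P [set w | forall i, X (t i) w <= x] =
  expeR (- ((x `^ (- alpha))%:E * sup_moment t)).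
Proof.
move=> It x0; have [mZ Z0 [dQ [OQ [Q [G [W]]]]]] := X_spectral.
move=> [[G0 GP] mW WZ GW XW].
have [mG _ _ _] := GP.
rewrite -(spectral_sup_law alpha_gt0 mZ Z0 G0 GP mW WZ GW It x0).
pose Y s w := ereal_sup (range (fun i => (G i w * W i s w)%:E)).
have -> : [set w | forall j i, G j w * W j (t i) w <= x] =
    [set w | forall i, (Y (t i) w <= x%:E)%E].
  apply/seteqP; split => w /= GWx; last first.
    move=> j i; rewrite -lee_fin; apply: le_trans (GWx i).
    by apply: ereal_sup_ubound; exists j.
  by move=> i; apply: ge_ereal_sup => _ [j _ <-]; rewrite lee_fin.
apply: eq_probability_forall => [i|i|n].
- exact: measurable_process_le X_process (It i).
- rewrite [X in measurable X](_ : _ =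
      \bigcap_j [set w | G j w * W j (t i) w <= x]).
    apply: bigcapT_measurable => j.
    have mGW : measurable_fun [set: OQ] (fun w => G j w * W j (t i) w).
      by apply: measurable_funM => //; exact: mW.
    by have := mGW measurableT _ (measurable_itv `]-oo, x]); rewrite setTI.
  apply/seteqP; split => w /=.
    move=> Yx j _ /=; rewrite -lee_fin; apply: le_trans Yx.
    by apply: ereal_sup_ubound; exists j.
  by move=> GWx; apply: ge_ereal_sup => _ [j _ <-]; rewrite lee_fin; exact: GWx.
pose B := \bigcap_(i in [set: 'I_n])
  [set s : n.-tuple (\bar R) | (tnth s i <= x%:E)%E].
have mB : measurable B.
  apply: fin_bigcap_measurable => [|i _]; first exact: finite_finset.
  have := @measurable_tnth _ (\bar R) n i measurableT _
    (emeasurable_itv `]-oo, x%:E]).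
  by rewrite setTI.
have := XW n (fun i => t i) (fun i => It i) B mB.
rewrite (_ : [set w | B [tuple _ | i < n]] =
  [set w | forall i : 'I_n, X (t i) w <= x]); last first.
  apply/seteqP; split => w /= Bw i.
    by have := Bw i Logic.I; rewrite /= tnth_mktuple lee_fin.
  by move=> _; rewrite /= tnth_mktuple lee_fin.
move=> ->; congr (Q _).
apply/seteqP; split => w /= Bw i.
  by have := Bw i Logic.I; rewrite /= tnth_mktuple.
by move=> _; rewrite /= tnth_mktuple; exact: Bw.
Qed.

(** At x = 1 the law of the supremum is exp(- [sup_moment]), and [expeR] is injective. So
    stationarity of X transfers to these moments of Z. *)
Lemma sup_moment_shift (t : nat -> R) (s : R) : stationary P I X ->
  (forall i, I (t i)) -> I s -> (forall i, I (t i + s)) ->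
  sup_moment (fun i => t i + s) = sup_moment t.
Proof.
move=> X_stationary It Is Its.
suff : P [set w | forall i, X (t i + s) w <= 1] =
       P [set w | forall i, X (t i) w <= 1].
  rewrite (@countable_sup_law (fun i => t i + s) 1 Its ltr01).
  rewrite (@countable_sup_law t 1 It ltr01) => /expeR_inj /oppe_inj.
  have -> : (1 `^ (- alpha))%:E = 1%E :> \bar R by rewrite powR1.
  by rewrite [LHS]mul1e [RHS]mul1e.
apply: eq_probability_forall => [i|i|n].
- exact: measurable_process_le X_process (Its i).
- exact: measurable_process_le X_process (It i).
pose B := \bigcap_(i in [set: 'I_n]) [set s : n.-tuple R | tnth s i <= 1].
have mB : measurable B.
  apply: fin_bigcap_measurable => [|i _]; first exact: finite_finset.
  have := @measurable_tnth _ R n i measurableT _ (measurable_itv `]-oo, 1]).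
  by rewrite setTI.
have BE (Y : R -> Omega -> R) : [set w | B [tuple Y (t i) w | i < n]] =
  [set w | forall i : 'I_n, Y (t i) w <= 1].
  apply/seteqP; split => w /= Bw i.
    by have := Bw i Logic.I; rewrite /= tnth_mktuple.
  by move=> _; rewrite /= tnth_mktuple.
have := X_stationary s Is n (fun i => t i) (fun i => It i) B mB.
by rewrite BE (BE (fun u => X (u + s))).
Qed.

End law_of_countable_suprema.

(** * Separability *)

Section separants.
Context (R : realType) (I : set R).
Context d (Omega : measurableType d) (P : probability Omega R).
Implicit Types (X : R -> Omega -> R) (D : set R).

Definition separant X D :=
  [/\ countable D, D `<=` I &
    {ae P, forall w, forall t, I t -> forall U, nbhs t U ->
      closure [set X s w | s in D `&` U] (X t w)}].

(* The endpoints of [[0, T]] have to be in [C]: they may only be approximated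
   from outside the interval. *)
Lemma separant_bound X D (T : R) (C : set R) : separant X D ->
  D `&` `[0, T] `<=` C -> C 0 -> (I T -> C T) ->
  {ae P, forall w, forall y : R, (forall s, C s -> X s w <= y) ->
    forall t, I t -> 0 <= t <= T -> X t w <= y}.
Proof.
move=> [_ _ sepD] DC C0 CT; apply: filterS sepD => w sepw y Cy t It /andP[t0 tT].
have [<-|t_neq0] := eqVneq 0 t; first exact: Cy.
have [tE|t_neqT] := eqVneq t T.
  by apply: Cy; rewrite tE; apply: CT; rewrite -tE.
have tU : nbhs t `]0, T[%classic.
  apply: near_in_itvoo; rewrite in_itv/= !lt_neqAle.
  by rewrite t_neq0 t0 t_neqT.
suff : closure `]-oo, y]%classic (X t w).
  by rewrite -(closure_id _).1 /= ?in_itv//; exact: interval_closed.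
apply: closureS (sepw t It _ tU) => _ [s [Ds sU] <-].
rewrite /= in_itv/=; apply: Cy; apply: DC; split => //.
by apply: subset_itv_oo_cc.
Qed.

End separants.

Section separating_sequences.
Context (R : realType) (I : set R).
Implicit Types (T : R).

Lemma time_domain0 : time_domain I -> I 0.
Proof. by move=> [->//|->]; exists 0. Qed.

Lemma time_domain_nat n : time_domain I -> I n%:R.
Proof. by move=> [->//|->]; exists n%:Z. Qed.

Lemma time_domainD s t : time_domain I -> I s -> I t -> I (s + t).
Proof.
move=> [->//|->] [m _ <-] [n _ <-].
by exists (m + n); rewrite ?intrD.
Qed.

Lemma time_domainB s t : time_domain I -> I s -> I t -> I (s - t).
Proof.
move=> [->//|->] [m _ <-] [n _ <-].
by exists (m - n); rewrite ?intrB.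
Qed.

Lemma countable_separant_self d (Omega : measurableType d)
    (P : probability Omega R) (X : R -> Omega -> R) :
  countable I -> separant I P X I.
Proof.
move=> cI; split => //; apply: nearW => w t It U tU.
by apply: subset_closure; exists t => //; split => //; exact: nbhs_singleton.
Qed.

Context d (Omega : measurableType d) (P : probability Omega R).
Context d' (Omega' : measurableType d') (P' : probability Omega' R).
Context (X : R -> Omega -> R) (Z : R -> Omega' -> R).
Context (I_domain : time_domain I) (Z_ge0 : forall t w, I t -> 0 <= Z t w).
Context (X_separable : separable_process P I X).
Context (Z_separable : I = [set: R] -> separable_process P' I Z).
Context (alpha : R) (alpha_gt0 : 0 < alpha).

(** Separability of Z is assumed in continuous time only; in discrete time I is countable and is its
    own separant. *)
Lemma exists_separants :
  exists D1 D2, separant I P X D1 /\ separant I P' Z D2.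
Proof.
have [D1 sepX] := X_separable.
have [IT|IZ] := I_domain.
  by have [D2 sepZ] := Z_separable IT; exists D1, D2.
exists D1, I; split => //; apply: countable_separant_self.
rewrite IZ; apply: (sub_countable (card_image_le _ _)).
exact: countableP.
Qed.

(** The sequence must be common to X and Z, because [countable_sup_law] relates the supremum of X
    over t to the moment of Z over the same t. *)
Lemma exists_separating_sequence T : 0 <= T -> exists t : nat -> R,
  [/\ forall i, I (t i) /\ 0 <= t i <= T,
    {ae P, forall w, sup_upto I T (X ^~ w) =
      ereal_sup (range (fun i => (X (t i) w)%:E))} &
    {ae P', forall w, sup_upto I T (fun s => Z s w `^ alpha) =
      ereal_sup (range (fun i => (Z (t i) w `^ alpha)%:E))}].
Proof.
move=> T0; have [D1 [D2 [sepX sepZ]]] := exists_separants.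
have I0 := time_domain0 I_domain.
(* The two separants, together with the endpoints that [separant_bound] asks for. The intersection
   in C removes what lies outside I or [0, T], possibly T itself. *)
pose F (k : 'I_4) := if val k is 0 then D1 else if val k is 1 then D2 else
  if val k is 2 then [set 0] else [set T].
pose C := (\bigcup_(k in [set: 'I_4]) F k) `&` [set s | I s /\ 0 <= s <= T].
have cC : countable C.
  apply: (@sub_countable _ _ _ (\bigcup_(k in [set: 'I_4]) F k)).
    by apply: subset_card_le => s [].
  apply: bigcup_countable => [|k _]; first exact: countableP.
  rewrite /F; case: (val k) => [|[|[|_]]]; [by case: sepX|by case: sepZ| |];
    exact: countable1.
have C0 : C 0.
  split; last by split => //=; rewrite lexx T0.
  by exists (@Ordinal 4 2 isT).
have CT : I T -> C T.
  move=> IT; split; last by split => //=; rewrite lexx T0.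
  by exists (@Ordinal 4 3 isT).
have D1C : D1 `&` `[0, T] `<=` C.
  move=> s [Ds]; rewrite /= in_itv/= => sT; split.
    by exists (@Ordinal 4 0 isT).
  by split => //; case: sepX => _ D1I _; exact: D1I.
have D2C : D2 `&` `[0, T] `<=` C.
  move=> s [Ds]; rewrite /= in_itv/= => sT; split.
    by exists (@Ordinal 4 1 isT).
  by split => //; case: sepZ => _ D2I _; exact: D2I.
have [t tC] : exists t : nat -> R, C = range t.
  have [CE|/surjfunPex//] : C = set0 \/ $|{surjfun [set: nat] >-> C}|.
    exact/pfcard_geP.
  by move: C0; rewrite CE.
have Ct i : C (t i) by rewrite tC; exists i.
exists t; split.
- by move=> i; have [_] := Ct i.
- have := separant_bound sepX D1C C0 CT; apply: filterS => w bound.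
  apply/eqP; rewrite eq_le; apply/andP; split; last first.
    apply: ge_ereal_sup => _ [i _ <-]; apply: ereal_sup_ubound.
    by exists (t i) => //; have [_ [? ?]] := Ct i; split; rewrite //= in_itv.
  apply: ge_ereal_sup => _ [s [sT Is] <-].
  set y := ereal_sup _.
  have ty i : ((X (t i) w)%:E <= y)%E by apply: ereal_sup_ubound; exists i.
  case: y ty => [y ty|_|ty]; [|by rewrite leey|by have := ty 0%N].
  rewrite lee_fin; apply: bound => //.
  by move=> r; rewrite tC => -[i _ <-]; rewrite -lee_fin.
- have := separant_bound sepZ D2C C0 CT; apply: filterS => w bound.
  apply/eqP; rewrite eq_le; apply/andP; split; last first.
    apply: ge_ereal_sup => _ [i _ <-]; apply: ereal_sup_ubound.
    by exists (t i) => //; have [_ [? ?]] := Ct i; split; rewrite //= in_itv.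
  apply: ge_ereal_sup => _ [s [sT Is] <-].
  set y := ereal_sup _.
  have ty i : ((Z (t i) w `^ alpha)%:E <= y)%E.
    by apply: ereal_sup_ubound; exists i.
  case: y ty => [y ty|_|ty]; [|by rewrite leey|by have := ty 0%N].
  have y0 : 0 <= y.
    by rewrite -lee_fin; apply: le_trans (ty 0%N); rewrite lee_fin powR_ge0.
  (* Separability concerns Z, so the bound y on Z ^ alpha is traded for the bound y ^ (1 / alpha) on
     Z. *)
  rewrite lee_fin powR_le ?Z_ge0//; apply: bound => //.
  move=> r; rewrite tC => -[i _ <-].
  by rewrite -powR_le -?lee_fin// lee_fin Z_ge0//; have [_ []] := Ct i.
Qed.

End separating_sequences.

(** * Growth of the moments of the suprema of Z *)

Section subadditive_growth.
Context (R : realType) (f : R -> R).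
Context (f_ge0 : forall T : R, 0 <= T -> 0 <= f T).
Context (f_nd : forall S T : R, 0 <= S <= T -> f S <= f T).
Context (f_sub : forall (n : nat) (T : R), 0 <= T -> f (n%:R + T) <= f n%:R + f T).

Lemma subadditive_mul (m q : nat) (T : R) : 0 <= T ->
  f ((q * m)%:R + T) <= q%:R * f m%:R + f T.
Proof.
move=> T0; elim: q => [|q IH]; first by rewrite mul0n add0r mul0r add0r.
rewrite mulSn natrD -addrA (le_trans (f_sub _ _)) ?addr_ge0//.
by rewrite -nat1r mulrDl mul1r -addrA lerD2l.
Qed.

(** Split T into q blocks of length m and a remainder shorter than m, whose value is at most f m by
    monotonicity. *)
Lemma subadditive_le (m : nat) (T : R) : (0 < m)%N -> 0 <= T ->
  f T <= (T / m%:R + 1) * f m%:R.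
Proof.
move=> m0 T0; pose q := Num.truncn (T / m%:R).
have mR : 0 < m%:R :> R by rewrite ltr0n.
have Tm0 : 0 <= T / m%:R by rewrite divr_ge0.
have /andP[qT Tq] := truncn_itv Tm0.
have qmT : (q * m)%:R <= T by rewrite natrM -ler_pdivlMr.
have -> : T = (q * m)%:R + (T - (q * m)%:R) by rewrite addrC subrK.
rewrite (le_trans (subadditive_mul _ _ _)) ?subr_ge0// subrKC.
rewrite mulrDl mul1r lerD ?ler_wpM2r ?f_ge0// f_nd// subr_ge0 qmT/=.
rewrite lerBlDl natrM; move: Tq.
by rewrite ltr_pdivrMr// -nat1r mulrDl mul1r addrC => /ltW.
Qed.

(** Fekete's argument along the integers, with the infimum of f m / m as limit; monotonicity of f
    fills in the real T. *)
Lemma subadditive_cvg : exists L : R, 0 <= L /\ f T / T @[T --> +oo%R] --> L.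
Proof.
pose S := [set f m.+1%:R / m.+1%:R | m in [set: nat]].
have S_lb : lbound S 0 by move=> _ [m _ <-]; rewrite divr_ge0 ?f_ge0.
have S_inf : has_inf S.
  by split; [exists (f 1%:R / 1%:R); exists 0%N|exists 0].
have L0 : 0 <= inf S.
  by apply: lb_le_inf => //; case: S_inf.
exists (inf S); split => //.
apply/cvgrPdist_le => e e0.
have e2 : 0 < e / 2 by rewrite divr_gt0.
have [_ [m _ <-] fmL] := inf_adherent e2 S_inf.
near=> T.
have T1 : 1 <= T by near: T; apply: nbhs_pinfty_ge; rewrite num_real.
have T0 : 0 < T by exact: lt_le_trans T1.
rewrite ler_distlC; apply/andP; split.
  (* Compare f T with its value at the integer part of T, which exceeds T - 1. The loss of inf S is
     at most e * T for large T. *)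
  have fT : (T - 1) * inf S <= f T.
    have /andP[nT Tn] := truncn_itv (ltW T0).
    have : (0 < Num.truncn T)%N by rewrite truncn_gt0.
    case: (Num.truncn T) nT Tn => // n nT Tn _.
    apply: (@le_trans _ _ (f n.+1%:R)); last by rewrite f_nd// ler0n.
    have : inf S <= f n.+1%:R / n.+1%:R.
      by apply: ge_inf; [exists 0|exists n].
    rewrite ler_pdivlMr ?ltr0n// => /(le_trans _); apply.
    by rewrite mulrC ler_wpM2l// lerBlDr natr1 ltW.
  rewrite ler_pdivlMr// (le_trans _ fT)// mulrBl mulrBl mul1r mulrC lerB//.
  by rewrite mulrC -ler_pdivrMr//; near: T; apply: nbhs_pinfty_ge;
    rewrite num_real.
(* Block length m comes within e / 2 of the infimum, and the extra term f m of [subadditive_le] is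
   at most T * e / 2 for large T. *)
rewrite ler_pdivrMr// (le_trans (@subadditive_le m.+1 T isT (ltW T0)))//.
have fm : f m.+1%:R / (e / 2) <= T.
  by near: T; apply: nbhs_pinfty_ge; rewrite num_real.
have {}fm : f m.+1%:R <= e / 2 * T by rewrite mulrC -ler_pdivrMr.
rewrite (splitr e) addrA [leRHS]mulrDl [leLHS]mulrDl mul1r lerD//.
by rewrite mulrAC -mulrA mulrC ler_wpM2r ?(ltW T0)// ltW.
Unshelve. all: end_near. Qed.

End subadditive_growth.

Lemma measurable_ereal_sup_range (R : realType) d (T : measurableType d)
    (u : nat -> T -> R) : (forall i, measurable_fun [set: T] (u i)) ->
  measurable_fun [set: T] (fun w => ereal_sup (range (fun i => (u i w)%:E))).
Proof.
move=> mu.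
rewrite (_ : (fun w => _) = fun w => esups (fun i => (u i w)%:E) 0%N); last first.
  apply/funext => w; rewrite /esups/= /sdrop; congr ereal_sup.
  by apply/seteqP; split => _ [i _ <-]; exists i.
by apply: measurable_fun_esups => i; exact/measurable_EFinP.
Qed.

(** * Finiteness, subadditivity and growth of H(T) *)

Section horizon_moments.
Context (R : realType) (alpha : R) (alpha_gt0 : 0 < alpha) (I : set R).
Context d (Omega : measurableType d) (P : probability Omega R).
Context d' (Omega' : measurableType d') (P' : probability Omega' R).
Context (X : R -> Omega -> R) (Z : R -> Omega' -> R).
Context (I_domain : time_domain I).
Context (X_process : stochastic_process I X).
Context (X_separable : separable_process P I X).
Context (X_stationary : stationary P I X).
Context (X_frechet : frechet_marginals P I alpha X).
Context (X_bounded : locally_bounded_paths P I X).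
Context (X_spectral : spectral_process I alpha P X P' Z).
Context (Z_separable : I = [set: R] -> separable_process P' I Z).

Definition horizon_moment (T : R) : \bar R :=
  \int[P']_w sup_upto I T (fun s => (Z s w `^ alpha)%R).

Let Z_ge0 t w : I t -> 0 <= Z t w.
Proof. by case: X_spectral => _ + _; exact. Qed.

Let I0 : I 0 := time_domain0 I_domain.

Lemma exists_horizon_sequence T : 0 <= T -> exists t : nat -> R,
  [/\ forall i, I (t i) /\ 0 <= t i <= T,
    {ae P, forall w, sup_upto I T (X ^~ w) =
      ereal_sup (range (fun i => (X (t i) w)%:E))} &
    sup_moment alpha P' Z t = horizon_moment T].
Proof.
move=> T0.
have [t [tT Xt Zt]] := exists_separating_sequence I_domain Z_ge0
  X_separable Z_separable alpha_gt0 T0.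
exists t; split => //; apply: ae_eq_integralT => [w|w|].
- apply: (@le_trans _ _ (Z (t 0%N) w `^ alpha)%:E).
    by rewrite lee_fin powR_ge0.
  by apply: ereal_sup_ubound; exists 0%N.
- apply: (@le_trans _ _ (Z 0 w `^ alpha)%:E); first by rewrite lee_fin powR_ge0.
  by apply: ereal_sup_ubound; exists 0 => //; split; rewrite //= in_itv/= lexx.
- by apply: filterS Zt => w ->.
Qed.

Lemma sup_moment_le (T : R) (t : nat -> R) :
  (forall i, I (t i) /\ 0 <= t i <= T) ->
  (sup_moment alpha P' Z t <= horizon_moment T)%E.
Proof.
move=> tT; apply: ge0_le_integralT => w.
  apply: (@le_trans _ _ (Z (t 0%N) w `^ alpha)%:E).
    by rewrite lee_fin powR_ge0.
  by apply: ereal_sup_ubound; exists 0%N.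
apply: ge_ereal_sup => _ [i _ <-]; apply: ereal_sup_ubound.
by exists (t i) => //; have [? ?] := tT i; split; rewrite //= in_itv.
Qed.

(** For the constant sequence 0, comparing the law of the supremum with the Frechet margin of X 0 at
    x = 1 gives E Z(0)^alpha = 1. *)
Lemma horizon_moment_ge1 T : 0 <= T -> (1 <= horizon_moment T)%E.
Proof.
move=> T0; pose t (i : nat) : R := 0.
apply: (@le_trans _ _ (sup_moment alpha P' Z t)); last first.
  by apply: sup_moment_le => i; rewrite /t lexx.
have := countable_sup_law alpha_gt0 X_process X_spectral (fun _ => I0) ltr01.
rewrite (_ : [set w | _] = [set w | X 0 w <= 1]); last first.
  by apply/seteqP; split => w /= => [/(_ 0%N)|Xw _].
rewrite (X_frechet I0 ltr01).
have -> : (1 `^ (- alpha)) = 1 :> R by rewrite powR1.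
rewrite [X in expeR (- X)]mul1e => /esym/(@expeR_inj R _ (- 1)%:E)/eqP.
by rewrite EFinN eqe_opp => /eqP ->.
Qed.

(** With an infinite moment, the law would give probability 0 to every event that X stays below n +
    1 along the sequence. Almost every path is bounded on [0, T], so these events cover the space up
    to a null set. *)
Lemma horizon_moment_lty T : 0 <= T -> (horizon_moment T < +oo)%E.
Proof.
move=> T0; have [t [tT Xt tE]] := exists_horizon_sequence T0.
have It i : I (t i) by have [] := tT i.
rewrite ltey; apply/negP => /eqP HT.
have null (n : nat) : P [set w | forall i, X (t i) w <= n.+1%:R] = 0%E.
  rewrite (countable_sup_law alpha_gt0 X_process X_spectral It) ?ltr0n//.
  by rewrite tE HT gt0_muley// lte_fin powR_gt0// ltr0n.
have mXt (n : nat) : measurable [set w | forall i, X (t i) w <= n.+1%:R].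
  rewrite [X in measurable X](_ : _ = \bigcap_i [set w | X (t i) w <= n.+1%:R]).
    apply: bigcapT_measurable => i.
    exact: (measurable_process_le n.+1%:R X_process (It i)).
  by apply/seteqP; split => w /= Xw // i; [move=> _|]; exact: Xw.
have neg : P.-negligible
    (\bigcup_(n : nat) [set w | forall i, X (t i) w <= n.+1%:R]).
  apply: negligible_bigcup => n.
  by apply/negligibleP; [exact: mXt|exact: null].
have : P.-negligible [set: Omega].
  case: X_bounded => N [mN N0 subN].
  have negN : P.-negligible N by exact/negligibleP.
  apply: negligibleS (negligibleU neg negN) => w _.
  have [Nw|Nw] := pselect (N w); [by right|left].
  have /contrapT bounded : ~ ~ (forall r : R, exists M : R,
      forall s, I s -> `|s| <= r -> `|X s w| <= M).
    by apply: contra_not Nw => /subN.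
  have [M XM] := bounded T.
  exists (Num.truncn M) => // i /=.
  have [Iti /andP[t0 tiT]] := tT i.
  rewrite (le_trans (ler_norm _))// (le_trans (XM _ Iti _)) ?ger0_norm//.
  exact/ltW/truncnS_gt.
move/negligibleP => /(_ measurableT) PT0.
by have := probability_setT P; rewrite PT0 => /eqP; rewrite eqe eq_sym oner_eq0.
Qed.

Lemma le_horizon_moment S T : 0 <= S -> S <= T ->
  (horizon_moment S <= horizon_moment T)%E.
Proof.
move=> S0 ST; apply: ge0_le_integralT => w.
  apply: (@le_trans _ _ (Z 0 w `^ alpha)%:E); first by rewrite lee_fin powR_ge0.
  by apply: ereal_sup_ubound; exists 0 => //; split; rewrite //= in_itv/= lexx.
apply: ereal_sup_le => _ [s [sS Is] <-]; exists s => //; split => //.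
move: sS; rewrite /= !in_itv/= => /andP[-> sS].
exact: le_trans sS ST.
Qed.

(* The part of the supremum over [n, n + T] is moved to [0, T] by
   sup_moment_shift, the only place where stationarity is needed. *)
Lemma horizon_momentD (n : nat) T : 0 <= T ->
  (horizon_moment (n%:R + T) <= horizon_moment n%:R + horizon_moment T)%E.
Proof.
move=> T0; have nT0 : 0 <= n%:R + T :> R by rewrite addr_ge0.
have [t [tnT _ <-]] := exists_horizon_sequence nT0.
have In : I n%:R := time_domain_nat n I_domain.
(* Indices belonging to the other half get time 0, or time n after the shift; these lie in I and add
   only nonnegative values. *)
pose t1 i := if t i <= n%:R then t i else 0.
pose t2 i := if t i <= n%:R then 0 else t i - n%:R.
have t1n i : I (t1 i) /\ 0 <= t1 i <= n%:R.
  have [It /andP[t0 _]] := tnT i.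
  by rewrite /t1; case: ifPn => [->|_]; rewrite ?t0// lexx ler0n.
have t2T i : I (t2 i) /\ 0 <= t2 i <= T.
  have [It /andP[t0 tT]] := tnT i.
  rewrite /t2; case: ifPn => [_|]; first by rewrite lexx T0.
  rewrite -ltNge => nt; split; first exact: time_domainB.
  by rewrite subr_ge0 ltW//= lerBlDl.
have It2n i : I (t2 i + n%:R) by apply: time_domainD => //; have [] := t2T i.
apply: (@le_trans _ _ (sup_moment alpha P' Z t1 + sup_moment alpha P' Z t2)%E);
  last by apply: leeD; exact: sup_moment_le.
rewrite -(@sup_moment_shift _ _ alpha_gt0 _ _ _ _ _ _ _ _ _ X_process X_spectral
  t2 n%:R X_stationary)//; last by move=> i; have [] := t2T i.
have sup_ge0 (u : nat -> R) w :
    (0 <= ereal_sup (range (fun i => (Z (u i) w `^ alpha)%:E)))%E.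
  apply: (@le_trans _ _ (Z (u 0%N) w `^ alpha)%:E).
    by rewrite lee_fin powR_ge0.
  by apply: ereal_sup_ubound; exists 0%N.
have [mZ _ _] := X_spectral.
have msup (u : nat -> R) : (forall i, I (u i)) -> measurable_fun [set: Omega']
    (fun w => ereal_sup (range (fun i => (Z (u i) w `^ alpha)%:E))).
  move=> Iu; apply: measurable_ereal_sup_range => i.
  apply: (measurableT_comp (measurable_powR _)); exact: mZ.
rewrite /sup_moment -ge0_integralD//; last 2 first.
- by apply: msup => i; have [] := t1n i.
- exact: msup.
apply: ge0_le_integralT => w //.
apply: ge_ereal_sup => _ [i _ <-].
have [tin|nti] := leP (t i) n%:R.
  rewrite -[leLHS]adde0 leeD//; apply: ereal_sup_ubound.
  by exists i; rewrite // /t1 tin.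
rewrite -[leLHS]add0e leeD//; apply: ereal_sup_ubound.
by exists i; rewrite // /t2 leNgt nti/= subrK.
Qed.

Lemma horizon_moment_fin T : 0 <= T -> horizon_moment T \is a fin_num.
Proof.
move=> T0; rewrite ge0_fin_numE ?horizon_moment_lty//.
exact: le_trans (horizon_moment_ge1 T0).
Qed.

Let h T := fine (horizon_moment T).

Let h_nd (S T : R) : 0 <= S <= T -> h S <= h T.
Proof.
move=> /andP[S0 ST]; have T0 := le_trans S0 ST.
by apply: fine_le; rewrite ?horizon_moment_fin// le_horizon_moment.
Qed.

Let h_sub (n : nat) (T : R) : 0 <= T -> h (n%:R + T) <= h n%:R + h T.
Proof.
move=> T0; rewrite /h -fineD ?horizon_moment_fin//.
rewrite fine_le ?horizon_moment_fin ?addr_ge0 ?horizon_momentD//.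
by rewrite fin_numD !horizon_moment_fin.
Qed.

Let h_ge0 (T : R) : 0 <= T -> 0 <= h T.
Proof.
by move=> T0; rewrite fine_ge0// (le_trans _ (horizon_moment_ge1 T0)).
Qed.

Lemma horizon_moment_cvg : exists L : R,
  0 <= L /\ fine (horizon_moment T) / T @[T --> +oo%R] --> L.
Proof. exact: (subadditive_cvg h_ge0 h_nd h_sub). Qed.

(** Unlike the limit, this bound holds at every horizon, which uniform integrability on T >= T0
    requires. *)
Lemma horizon_moment_linear (T : R) : 0 <= T ->
  fine (horizon_moment T) <= (T + 1) * fine (horizon_moment 1).
Proof.
move=> T0; have := subadditive_le h_ge0 h_nd h_sub (ltn0Sn 0) T0.
by rewrite divr1.
Qed.

End horizon_moments.

(** * Moments of the Frechet distribution *)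

Section integral_density.
Context d (T : measurableType d) (R : realType).
Local Open Scope ereal_scope.
Import HBNNSimple.

(** Linearity gives the formula for simple functions, monotone convergence the rest. *)
Lemma ge0_integral_density (mu nu : {measure set T -> \bar R}) (f : T -> R)
    (g : T -> \bar R) :
  (forall x, 0 <= f x)%R -> measurable_fun [set: T] f ->
  (forall A, measurable A -> nu A = \int[mu]_(x in A) (f x)%:E) ->
  (forall x, 0 <= g x) -> measurable_fun [set: T] g ->
  \int[nu]_x g x = \int[mu]_x (g x * (f x)%:E).
Proof.
move=> f0 mf nuE g0 mg.
pose h := nnsfun_approx measurableT mg.
have mfE : measurable_fun [set: T] (EFin \o f) by exact/measurable_EFinP.
have h_nd x : nondecreasing_seq (fun n => (h n x)%:E).
  by move=> m n mn; rewrite lee_fin; exact/lefP/nd_nnsfun_approx.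
have hg x : (h n x)%:E @[n --> \oo] --> g x.
  exact: (cvg_nnsfun_approx measurableT mg).
have int_h n : \int[nu]_x (h n x)%:E = \int[mu]_x ((h n x)%:E * (f x)%:E).
  have fin_h : finite_set (range (h n)) by exact: fimfunP.
  have mh r : measurable (h n @^-1` [set r]) by exact: measurable_funPTI.
  rewrite integralT_nnsfun sintegralE fsbig_finite//.
  transitivity (\int[mu]_x \sum_(r <- fset_set (range (h n)))
      `|r|%:E * ((f x)%:E * (\1_(h n @^-1` [set r]) x)%:E)).
    rewrite ge0_integral_sum//.
    - rewrite big_seq [RHS]big_seq; apply: eq_bigr => r.
      rewrite in_fset_set// inE => -[x _ hx].
      rewrite ge0_integralZl//.
      + rewrite nuE// integral_mkcond ger0_norm -?hx//; congr (_ * _).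
        apply: eq_integral => y _; rewrite patchE indicE.
        by case: ifPn => _; rewrite ?mule1 ?mule0.
      + apply: emeasurable_funM => //; apply/measurable_EFinP.
        exact: measurable_indic.
      + by move=> y _; rewrite -EFinM lee_fin mulr_ge0.
    - move=> r; apply: measurable_funeM; apply: emeasurable_funM => //.
      by apply/measurable_EFinP; exact: measurable_indic.
    - by move=> r y _; rewrite -!EFinM lee_fin !mulr_ge0.
  apply: eq_integral => x _; rewrite [in RHS]fimfunE fsbig_finite//=.
  rewrite -EFinM mulr_suml -sumEFin big_seq [RHS]big_seq; apply: eq_bigr => r.
  rewrite in_fset_set// inE => -[y _ hy].
  by rewrite -!EFinM ger0_norm -?hy// mulrA mulrAC.
transitivity (\int[nu]_x limn (fun n => (h n x)%:E)).
  by apply: eq_integral => x _; exact/esym/cvg_lim.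
transitivity (\int[mu]_x limn (fun n => (h n x)%:E * (f x)%:E)); last first.
  by apply: eq_integral => x _; apply/cvg_lim => //; exact: cvgeZr.
rewrite !monotone_convergence//.
- by congr (limn _); apply/funext => n; exact: int_h.
- by move=> n; apply: emeasurable_funM => //; exact/measurable_EFinP.
- by move=> n x _; rewrite -EFinM lee_fin mulr_ge0.
- by move=> x _ m n mn; rewrite lee_wpmul2r ?lee_fin//; exact: h_nd.
- by move=> n; exact/measurable_EFinP.
- by move=> n x _; rewrite lee_fin.
Qed.

End integral_density.

Section exponential_law.
Context (R : realType).
Local Notation mu := (@lebesgue_measure R).

Lemma exponential_prob_tail (s : R) : 0 <= s ->
  exponential_prob 1 `[s, +oo[ = (expR (- s))%:E.
Proof.
move=> s0; rewrite /exponential_prob.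
have sub0 : `]s, +oo[%classic `<=` `]0, +oo[%classic.
  by move=> x; rewrite /= !in_itv/= !andbT; exact: le_lt_trans.
rewrite (@ge0_continuous_FTC2y _ _ (fun x => - (expR (- 1 * x))) _ 0)//.
- by rewrite EFinN oppeK add0e mulN1r.
- by move=> x _; exact: exponential_pdf_ge0.
- apply: (@continuous_subspaceW R^o _ _ `[0, +oo[%classic).
    by move=> x; rewrite /= !in_itv/= !andbT; exact: le_trans.
  exact: within_continuous_exponential_pdf.
- rewrite -oppr0; apply: cvgN.
  under eq_fun do rewrite mulN1r; exact: cvgr_expR.
- apply: cvgN; apply/cvg_at_right_filter.
  apply: continuous_comp; last exact: continuous_expR.
  by apply: cvgMl_tmp; exact: cvg_id.
- move=> x xs; apply: derive1_exponential_pdf.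
  by move: xs; rewrite !in_itv/= !andbT; exact: le_lt_trans.
Qed.

Lemma measurable_Gamma_integrand (b : R) (D : set R) :
  measurable_fun D (fun t : R => (t `^ b * expR (- t))%:E).
Proof.
apply: measurable_funTS; apply/measurable_EFinP; apply: measurable_funM.
  exact: measurable_powR.
by apply: measurableT_comp => //; exact: measurable_expR.
Qed.

Lemma integral_exponential_powR (nu : {measure set (measurableTypeR R) -> \bar R})
    (b : R) : (forall A, measurable A -> nu A = exponential_prob 1 A) ->
  (\int[nu]_s (s `^ (- b))%:E = Gamma (1 - b))%E.
Proof.
move=> nuE.
rewrite (@ge0_integral_density _ _ _ mu nu (exponential_pdf 1)).
- rewrite /Gamma integral_itv_obnd_cbnd; last exact: measurable_Gamma_integrand.
  rewrite [RHS]integral_mkcond; apply: eq_integral => s _.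
  rewrite /exponential_pdf !patchE; case: ifPn => _; last by rewrite mule0.
  by rewrite -EFinM mul1r mulN1r addrAC subrr add0r.
- by move=> x; exact: exponential_pdf_ge0.
- exact: measurable_exponential_pdf.
- by move=> A mA; rewrite nuE.
- by move=> x; rewrite lee_fin powR_ge0.
- by apply/measurable_EFinP; exact: measurable_powR.
Qed.

Lemma integral_powRB1 (x a : R) : 0 < x -> 0 < a -> a < 1 ->
  (\int[mu]_(t in `[a, 1%R]) (t `^ (x - 1))%:E)%E = ((1 - a `^ x) / x)%:E.
Proof.
move=> x0 a0 a1.
have cont (p t : R) : 0 < t -> {for t, continuous (@powR R ^~ p)}.
  move=> t0; apply/differentiable_continuous/derivable1_diffP.
  by apply: derivable_powR; rewrite in_itv/= t0.
have der (t : R) : 0 < t -> derivable (fun t : R => t `^ x) t 1.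
  by move=> t0; apply: derivable_powR; rewrite in_itv/= t0.
rewrite (@continuous_FTC2 _ _ (fun t => x^-1 * t `^ x))//.
- by rewrite powR1 -EFinB -mulrBr mulrC.
- apply: (@continuous_in_subspaceT R^o R^o) => t.
  rewrite inE/= in_itv/= => /andP[at1 _].
  by apply: cont; exact: lt_le_trans at1.
- split.
  + move=> t; rewrite in_itv/= => /andP[at1 _].
    by apply: derivableM => //; apply: der; exact: lt_trans at1.
  + by apply: cvg_at_right_filter; apply: cvgMl_tmp; exact: cont.
  + by apply: cvg_at_left_filter; apply: cvgMl_tmp; exact: cont.
- move=> t; rewrite in_itv/= => /andP[at1 _].
  have t0 : 0 < t := lt_trans a0 at1.
  rewrite derive1Ml; last exact: der.
  by rewrite powR_derive1 ?in_itv/= ?t0// mulrA mulVf ?gt_eqF// mul1r.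
Qed.

(** On ]0, 1] drop the exponential: the integral of t ^ (x - 1) is at most 1 / x. Beyond 1 the power
    is at most 1 because x <= 1, leaving the exponential density. *)
Lemma Gamma_lty (x : R) : 0 < x -> x <= 1 -> (Gamma x < +oo)%E.
Proof.
move=> x0 x1; rewrite /Gamma.
have f_ge0 t : (0 <= (t `^ (x - 1) * expR (- t))%:E)%E.
  by rewrite lee_fin mulr_ge0 ?powR_ge0 ?expR_ge0.
have mf D := @measurable_Gamma_integrand (x - 1) D.
have -> : `]0, +oo[%classic = `]0, 1]%classic `|` `]1, +oo[%classic :> set R.
  by rewrite -itv_bndbnd_setU// bnd_simp.
rewrite ge0_integral_setU//=; last 2 first.
- exact: mf.
- rewrite disj_set2E; apply/eqP/seteqP; split => t //= [].
  by rewrite !in_itv/= andbT => /andP[_ t1] /(le_lt_trans t1); rewrite ltxx.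
apply: lte_add_pinfty; last first.
  apply: (@le_lt_trans _ _
      (\int[mu]_(t in `]1%R, +oo[) (exponential_pdf 1%R t)%:E)%E).
    apply: ge0_le_integral => //.
    - exact: mf.
    - by apply/measurable_funTS/measurable_EFinP; exact: measurable_exponential_pdf.
    - move=> t; rewrite /= in_itv/= andbT => t1.
      rewrite lee_fin exponential_pdfE ?(ltW (lt_trans ltr01 t1))//.
      rewrite mul1r mulN1r -[leRHS]mul1r ler_wpM2r ?expR_ge0//.
      by rewrite -[leRHS](powRr0 t) ler_powR ?(ltW t1)// subr_le0.
  apply: (@le_lt_trans _ _ (\int[mu]_t (exponential_pdf 1%R t)%:E)%E).
    apply: ge0_subset_integral => //.
    - by apply/measurable_EFinP; exact: measurable_exponential_pdf.
    - by move=> t _; rewrite lee_fin exponential_pdf_ge0.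
  by rewrite integral_exponential_pdf// ltry.
(* The index n.+2 keeps the left end strictly below 1, as [integral_powRB1] asks. *)
pose F n : set R := `[n.+2%:R^-1, 1]%classic.
have -> : `]0, 1]%classic = \bigcup_n F n.
  apply/seteqP; split => t /=.
    rewrite in_itv/= => /andP[t0 t1].
    exists (Num.truncn t^-1) => //; rewrite /F/= in_itv/= t1 andbT.
    rewrite invf_ple ?posrE//; apply: ltW; apply: (lt_le_trans (truncnS_gt _)).
    by rewrite ler_nat.
  move=> [n _]; rewrite /F/= !in_itv/= => /andP[nt ->]; rewrite andbT.
  by apply: lt_le_trans nt; rewrite invr_gt0 ltr0n.
apply: (@le_lt_trans _ _ (x^-1)%:E); last exact: ltry.
have F_nd : nondecreasing_seq F.
  move=> m n mn; rewrite subsetEset; apply: subset_itvr.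
  by rewrite bnd_simp lef_pV2 ?posrE// ler_nat.
have cvgF := ge0_nondecreasing_set_cvg_integral (mu := mu) F_nd
  (fun n => measurable_itv _) (fun n => mf (F n)) (fun n t _ => f_ge0 t).
rewrite -(cvg_lim _ cvgF)//; apply: lime_le.
  by apply/cvg_ex; eexists; exact: cvgF.
apply: nearW => n.
have n0 : 0 < n.+2%:R^-1 :> R by rewrite invr_gt0.
have n1 : n.+2%:R^-1 < 1 :> R by rewrite invf_lt1// ltr1n.
apply: (@le_trans _ _ (\int[mu]_(t in F n) (t `^ (x - 1))%:E)%E).
  apply: ge0_le_integral => //.
  - exact: measurable_itv.
  - exact: mf.
  - by apply/measurable_funTS/measurable_EFinP; exact: measurable_powR.
  - move=> t; rewrite /F/= in_itv/= => /andP[nt _].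
    rewrite lee_fin -[leRHS]mulr1 ler_wpM2l ?powR_ge0//.
    by rewrite expR_le1 oppr_le0 (le_trans _ nt)// ltW.
rewrite integral_powRB1// lee_fin -[leRHS]mul1r ler_wpM2r ?invr_ge0 ?(ltW x0)//.
Qed.

End exponential_law.

Section frechet_moment.
Context (R : realType) d (Omega : measurableType d) (P : probability Omega R).
Context (Y : Omega -> R) (mY : measurable_fun [set: Omega] Y).
Context (c alpha : R) (c_gt0 : 0 < c) (alpha_gt0 : 0 < alpha).
Context (Y_cdf : forall x : R, 0 < x ->
  P [set w | Y w <= x] = (expR (- (c * x `^ (- alpha))))%:E).

Let mYle x : measurable [set w | Y w <= x].
Proof.
by have := @mY measurableT _ (measurable_itv `]-oo, x]); rewrite setTI.
Qed.

(** The distribution function is given at positive x only. Choosing x with c * x ^ (- alpha) = n + 1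
    bounds the probability by exp(- (n + 1)). *)
Lemma frechet_le0 : P [set w | Y w <= 0] = 0%E.
Proof.
apply/eqP; rewrite eq_le measure_ge0 andbT; apply/lee_addgt0Pr => e e0.
rewrite add0e.
have [n ne] : exists n : nat, expR (- n.+1%:R) <= e.
  exists (Num.truncn e^-1).
  rewrite expRN invf_ple ?posrE ?expR_gt0//.
  apply: (le_trans (ltW (truncnS_gt e^-1))).
  by rewrite (le_trans _ (expR_ge1Dx _))// lerDr.
pose x := (c / n.+1%:R) `^ alpha^-1.
have x0 : 0 < x by apply: powR_gt0; rewrite divr_gt0.
have xE : c * x `^ (- alpha) = n.+1%:R.
  rewrite /x -powRrM mulrN mulVf ?gt_eqF// powR_inv1 ?divr_ge0 ?(ltW c_gt0)//.
  by rewrite invf_div mulrC divfK ?gt_eqF.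
apply: (@le_trans _ _ (P [set w | Y w <= x])).
  by apply: le_measure; rewrite ?inE// => w /= /le_trans; apply; exact: ltW.
by rewrite Y_cdf// lee_fin xE.
Qed.

(** Where Y <= 0 the power takes a default value; by [frechet_le0] this happens with probability
    0. *)
Let S w := c * Y w `^ (- alpha).

Let mS : measurable_fun [set: Omega] S.
Proof.
apply: measurable_funM => //.
exact: (measurableT_comp (measurable_powR (- alpha)) mY).
Qed.

(* S is standard exponential, and Y^beta is proportional to S^(-beta/alpha). *)
Lemma frechet_exponential (s : R) : 0 < s -> P [set w | s <= S w] = (expR (- s))%:E.
Proof.
move=> s0; have cs0 : 0 < c / s by rewrite divr_gt0.
pose x := (c / s) `^ alpha^-1.
have x0 : 0 < x by exact: powR_gt0.
have xE : c * x `^ (- alpha) = s.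
  rewrite /x -powRrM mulrN mulVf ?gt_eqF//.
  rewrite powR_inv1 ?divr_ge0 ?(ltW c_gt0) ?(ltW s0)//.
  by rewrite invf_div mulrC divfK ?gt_eqF.
rewrite -xE -(Y_cdf x0).
have mSs : measurable [set w | c * x `^ (- alpha) <= S w].
  have := @mS measurableT _ (measurable_itv `[c * x `^ (- alpha), +oo[).
  rewrite setTI; congr measurable.
  by apply/seteqP; split => w /=; rewrite in_itv/= andbT.
have SY w : 0 < Y w -> (c * x `^ (- alpha) <= S w) = (Y w <= x).
  move=> Yw; rewrite /S ler_pM2l// !powRN lef_pV2 ?posrE ?powR_gt0//.
  apply/idP/idP => [|Yx]; last first.
    by rewrite ge0_ler_powR ?nnegrE ?(ltW Yw) ?(ltW x0) ?(ltW alpha_gt0).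
  apply: contraTT; rewrite -!ltNge => ?.
  by rewrite gt0_ltr_powR ?nnegrE ?(ltW Yw) ?(ltW x0).
(* Events are intersected with 0 < Y, where the power is strictly decreasing and the two conditions
   are equivalent. *)
have null A : measurable A -> P A = P (A `&` [set w | 0 < Y w]).
  move=> mA; pose N := [set w | Y w <= 0].
  have AE : A `&` [set w | 0 < Y w] = A `\` N.
    congr (A `&` _); apply/seteqP; split => u; rewrite /N/= ltNge => /negP //.
  have mN : measurable N by exact: mYle.
  have PN : P (A `&` N) = 0%E.
    apply/eqP; rewrite eq_le measure_ge0 andbT -frechet_le0.
    by apply: le_measure => [||u []//]; rewrite inE//; exact: measurableI.
  have fin_A : (P A < +oo)%E by rewrite (le_lt_trans (probability_le1 P mA)) ?ltry.
  by rewrite AE measureD// [X in (_ - X)%E]PN sube0.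
apply: (etrans (null _ mSs)); apply: (etrans _ (esym (null _ (mYle x)))).
congr (P _).
by apply/seteqP; split => u /= [uS Yu]; split => //; move: uS; rewrite SY.
Qed.

Let mS' : measurable_fun [set: Omega] (S : Omega -> measurableTypeR R) := mS.

(** Tails on closed half lines, a pi-system, identify the law of S, and the moment becomes an
    exponential integral. Both sides may be infinite, so beta is arbitrary. *)
Lemma frechet_moment (beta : R) :
  (\int[P]_w (Y w `^ beta)%:E =
   (c `^ (beta / alpha))%:E * Gamma (1 - beta / alpha))%E.
Proof.
pose Srv : {RV P >-> measurableTypeR R} :=
  HB.pack (S : Omega -> measurableTypeR R)
    (isMeasurableFun.Build _ _ _ _ (S : Omega -> measurableTypeR R) mS').
pose nu : probability (measurableTypeR R) R := distribution P Srv.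
pose ex : probability (measurableTypeR R) R :=
  exponential_distribution_exponential_prob__canonical__probability_measure_Probability
    (@ltr01 R).
have S_ge0 w : 0 <= S w by rewrite mulr_ge0 ?powR_ge0 ?(ltW c_gt0).
(* Half lines starting at s <= 0 have full mass for both laws, since S is nonnegative; the others
   are [frechet_exponential]. *)
have nu_tail (s : R) : nu `[s, +oo[%classic = ex `[s, +oo[%classic.
  have nuE : nu `[s, +oo[%classic = P [set w | s <= S w].
    by congr (P _); apply/seteqP; split => w /=; rewrite in_itv/= andbT.
  rewrite nuE; have [s0|s0] := leP s 0; last first.
    by rewrite frechet_exponential// -exponential_prob_tail// ltW.
  rewrite (_ : [set w | _] = setT); last first.
    by apply/seteqP; split => w //= _; exact: le_trans s0 (S_ge0 w).
  rewrite probability_setT; apply/eqP; rewrite eq_le; apply/andP; split.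
    rewrite (_ : 1%E = ex `[0%R, +oo[%classic).
      by apply: le_measure; rewrite ?inE//; exact: subset_itvr.
    by have := @exponential_prob_tail R 0 (lexx _); rewrite oppr0 expR0.
  exact: probability_le1.
have nu_ex A : measurable A -> nu A = exponential_prob 1 A.
  move=> mA.
  suff : nu A = ex A by [].
  have uniq := @measure_unique _ R (measurableTypeR R) (@RGenCInfty.G R)
    (fun k => `[(- k%:R), +oo[%classic) _ _ _ _ nu ex _ _ A mA.
  apply: uniq => //.
  - exact: RGenCInfty.measurableE.
  - move=> _ _ [x ->] [y ->]; exists (Num.max x y).
    by apply/seteqP; split => u; rewrite /= !in_itv/= !andbT ge_max => /andP.
  - by move=> k; exists (- k%:R).
  - apply/seteqP; split => // u _; exists (Num.truncn (- u)).+1 => //=.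
    by rewrite in_itv/= andbT lerNl ltW// truncnS_gt.
  - by move=> _ [x ->]; exact: nu_tail.
  - by move=> k; rewrite (le_lt_trans (probability_le1 _ _)) ?ltry//;
      exact: measurable_itv.
pose b := beta / alpha.
have mSb : measurable_fun [set: measurableTypeR R] (fun s : R => (s `^ (- b))%:E).
  by apply/measurable_EFinP; exact: measurable_powR.
rewrite -(integral_exponential_powR b nu_ex).
rewrite ge0_integral_distribution//; last by move=> s; rewrite lee_fin powR_ge0.
rewrite -ge0_integralZl//; last 3 first.
- exact: (measurableT_comp mSb mS').
- by move=> w _; rewrite lee_fin powR_ge0.
- by rewrite lee_fin powR_ge0.
apply: ae_eq_integralT.
- by move=> w; rewrite lee_fin powR_ge0.
- by move=> w; rewrite -EFinM lee_fin mulr_ge0 ?powR_ge0.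
exists [set w | Y w <= 0]; split; [exact: mYle|exact: frechet_le0|].
move=> w /=; apply: contra_notP => /negP; rewrite -ltNge => Yw.
rewrite /= -EFinM; congr EFin; rewrite /S powRM ?powR_ge0 ?(ltW c_gt0)//.
rewrite mulrA -powRD; last by apply/implyP => _; rewrite gt_eqF.
by rewrite subrr powRr0 mul1r -powRrM mulrNN /b mulrCA mulfV ?gt_eqF// mulr1.
Qed.

End frechet_moment.

(** * Normalized suprema *)

(** The limit 0 gets its own argument: the Pickands constant may vanish, and a power need not be
    differentiable at 0. *)
Lemma cvg_powR (R : realType) (F : set_system R) {FF : Filter F} (u : R -> R)
    (L p : R) : 0 < p -> 0 <= L -> (forall x, 0 <= u x) ->
  u x @[x --> F] --> L -> u x `^ p @[x --> F] --> L `^ p.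
Proof.
move=> p0; rewrite le_eqVlt => /predU1P[<-|L0] u0 uL; last first.
  apply: (@continuous_cvg _ _ _ _ _ u (@powR R ^~ p)) => //.
  apply/differentiable_continuous/derivable1_diffP.
  by apply: derivable_powR; rewrite in_itv/= L0.
rewrite powR0 ?gt_eqF//; apply/cvgrPdist_le => e e0.
have ep0 : 0 < e `^ p^-1 by exact: powR_gt0.
move/cvgrPdist_le : uL => /(_ _ ep0); apply: filterS => x.
rewrite !sub0r !normrN !ger0_norm ?powR_ge0// => ux.
by rewrite powR_le ?(ltW e0).
Qed.

Section normalized_suprema.
Context (R : realType) (alpha : R) (alpha_gt0 : 0 < alpha) (I : set R).
Context d (Omega : measurableType d) (P : probability Omega R).
Context d' (Omega' : measurableType d') (P' : probability Omega' R).
Context (X : R -> Omega -> R) (Z : R -> Omega' -> R).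
Context (I_domain : time_domain I).
Context (X_process : stochastic_process I X).
Context (X_separable : separable_process P I X).
Context (X_stationary : stationary P I X).
Context (X_frechet : frechet_marginals P I alpha X).
Context (X_bounded : locally_bounded_paths P I X).
Context (X_spectral : spectral_process I alpha P X P' Z).
Context (Z_separable : I = [set: R] -> separable_process P' I Z).

Let h (T : R) : R := fine (horizon_moment alpha I P' Z T).

Let h_fin (T : R) : 0 <= T -> horizon_moment alpha I P' Z T \is a fin_num.
Proof.
exact: (horizon_moment_fin alpha_gt0 I_domain X_process X_separable X_frechet
  X_bounded X_spectral Z_separable).
Qed.

Let h_gt0 T : 0 <= T -> 0 < h T.
Proof.
move=> T0; rewrite (@lt_le_trans _ _ 1)// -lee_fin /h fineK ?h_fin//.
exact: (horizon_moment_ge1 alpha_gt0 I_domain X_process X_frechet X_spectral).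
Qed.

(** Y is a measurable, real-valued version taken along a separating sequence; it is finite almost
    surely because paths are locally bounded. *)
Lemma normalized_sup_version (T : R) : 0 < T -> exists Y : Omega -> R,
  [/\ measurable_fun [set: Omega] Y,
    {ae P, forall w, normalized_sup I alpha X T w = (Y w)%:E} &
    forall beta : R, (\int[P]_w (Y w `^ beta)%:E =
      ((h T / T) `^ (beta / alpha))%:E * Gamma (1 - beta / alpha))%E].
Proof.
move=> T0; have T0' := ltW T0.
have [t [tT Xt tE]] := exists_horizon_sequence alpha_gt0 I_domain
  X_separable X_spectral Z_separable T0'.
have It i : I (t i) by have [] := tT i.
pose U w := ereal_sup (range (fun i => (X (t i) w)%:E)).
have mU : measurable_fun [set: Omega] U.
  by apply: measurable_ereal_sup_range => i; exact: X_process.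
have U_fin : {ae P, forall w, U w \is a fin_num}.
  apply: filterS X_bounded => w bounded; have [M XM] := bounded T.
  rewrite fin_numElt; apply/andP; split.
    apply: (@lt_le_trans _ _ (X (t 0%N) w)%:E); first exact: ltNyr.
    by apply: ereal_sup_ubound; exists 0%N.
  apply: (@le_lt_trans _ _ M%:E); last exact: ltry.
  apply: ge_ereal_sup => _ [i _ <-]; rewrite lee_fin.
  have [Iti /andP[t0 tiT]] := tT i.
  by rewrite (le_trans (ler_norm _))// XM// ger0_norm.
pose k := T `^ (- alpha^-1); have k0 : 0 < k by exact: powR_gt0.
pose Y w := k * fine (U w).
have mY : measurable_fun [set: Omega] Y.
  by apply: measurable_funM => //; exact: measurableT_comp.
exists Y; split => //.
  apply: filterS2 Xt U_fin => w UE U_fin.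
  by rewrite /normalized_sup UE -/(U w) -[in LHS](fineK U_fin).
move=> beta; apply: frechet_moment => //; first by rewrite divr_gt0// h_gt0.
move=> x x0; have y0 : 0 < x / k by rewrite divr_gt0.
transitivity (P [set w | forall i, X (t i) w <= x / k]); last first.
  rewrite (countable_sup_law alpha_gt0 X_process X_spectral It y0) tE.
  rewrite -(fineK (h_fin T0')) -/(h T) /=; congr (expR (- _))%:E.
  have -> : (x / k) `^ (- alpha) = x `^ (- alpha) / T.
    rewrite powRM ?invr_ge0 ?(ltW x0) ?(ltW k0)//; congr (_ * _).
    rewrite -powR_inv1 ?(ltW k0)// -powRrM /k -powRrM.
    rewrite mulN1r opprK mulNr mulVf ?gt_eqF//.
    by rewrite powR_inv1// ltW.
  by ring.
have mA : measurable [set w | Y w <= x].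
  by have := mY measurableT _ (measurable_itv `]-oo, x]); rewrite setTI.
have mB : measurable [set w | forall i, X (t i) w <= x / k].
  rewrite [X in measurable X](_ : _ = \bigcap_i [set w | X (t i) w <= x / k]).
    apply: bigcapT_measurable => i.
    exact: (measurable_process_le (x / k) X_process (It i)).
  by apply/seteqP; split => w /= Xw // i; [move=> _|]; exact: Xw.
(* Where U is infinite, [fine] returns 0 and the two events may differ, so their indicators are
   compared almost everywhere. *)
have -> : P [set w | Y w <= x] = (\int[P]_w (\1_[set w | Y w <= x] w)%:E)%E.
  by rewrite integral_indic// setIT.
have -> : P [set w | forall i, X (t i) w <= x / k] =
    (\int[P]_w (\1_[set w | forall i, X (t i) w <= x / k] w)%:E)%E.
  by rewrite integral_indic// setIT.
apply: ae_eq_integralT => [w|w|]; rewrite ?lee_fin//.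
apply: filterS U_fin => w U_fin; congr EFin; rewrite !indicE.
congr (nat_of_bool _)%:R; apply/idP/idP => /set_mem /= wx; apply/mem_set => /=.
  move=> i; rewrite ler_pdivlMr// mulrC; apply: le_trans wx.
  rewrite ler_pM2l// -lee_fin fineK//.
  by apply: ereal_sup_ubound; exists i.
rewrite /Y mulrC -ler_pdivlMr// -lee_fin fineK//.
by apply: ge_ereal_sup => _ [i _ <-]; rewrite lee_fin.
Qed.

Lemma normalized_sup_moment (T beta : R) : 0 < T ->
  (\int[P]_w (normalized_sup I alpha X T w `^ beta) =
   ((h T / T) `^ (beta / alpha))%:E * Gamma (1 - beta / alpha))%E.
Proof.
move=> /normalized_sup_version[Y [mY YE Ymoment]].
rewrite -Ymoment; apply: ae_eq_integralT => [w|w|].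
- exact: poweR_ge0.
- by rewrite lee_fin powR_ge0.
- by apply: filterS YE => w ->; rewrite poweR_EFin.
Qed.

Lemma pickands_horizon (L : R) : h T / T @[T --> +oo%R] --> L ->
  pickands P' I alpha Z = L%:E.
Proof.
move=> hL; apply/cvg_lim => //.
apply: (@cvg_trans _ ((h T / T)%:E @[T --> +oo%R])); last first.
  by apply: cvg_EFin; first exact: nearW.
apply: near_eq_cvg; near=> T.
have T0 : 0 <= T by near: T; apply: nbhs_pinfty_ge; rewrite num_real.
by rewrite -/(horizon_moment alpha I P' Z T) -(fineK (h_fin T0)) -/(h T) -EFinM mulrC.
Unshelve. all: end_near. Qed.

Let Gamma_fin (beta : R) : 0 < beta < alpha ->
  Gamma (1 - beta / alpha) \is a fin_num.
Proof.
move=> /andP[b0 ba]; rewrite ge0_fin_numE; last first.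
  by apply: integral_ge0 => t _; rewrite lee_fin mulr_ge0 ?powR_ge0 ?expR_ge0.
apply: Gamma_lty; first by rewrite subr_gt0 ltr_pdivrMr// mul1r.
by rewrite gerBl divr_ge0 ?ltW.
Qed.

Lemma normalized_sup_moment_cvg (beta : R) : 0 < beta < alpha ->
  (\int[P]_w (normalized_sup I alpha X T w `^ beta) @[T --> +oo%R] -->
    pickands P' I alpha Z `^ (beta / alpha) * Gamma (1 - beta / alpha))%E /\
  (pickands P' I alpha Z `^ (beta / alpha) * Gamma (1 - beta / alpha) < +oo)%E.
Proof.
move=> b_alpha; have /andP[b0 ba] := b_alpha.
have [L [L0 hL]] : exists L : R, 0 <= L /\ h T / T @[T --> +oo%R] --> L.
  exact: (horizon_moment_cvg alpha_gt0 I_domain X_process X_separable X_stationary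
    X_frechet X_bounded X_spectral Z_separable).
rewrite (pickands_horizon hL) poweR_EFin -(fineK (Gamma_fin b_alpha)).
split; last by rewrite -EFinM ltry.
set g := fine _.
(* [cvg_powR] wants a function that is nonnegative everywhere, while h T / T is so only for positive
   T; the maximum with 0 repairs this. *)
apply: (@cvg_trans _
  ((Num.max 0 (h T / T) `^ (beta / alpha) * g)%:E @[T --> +oo%R])).
  apply: near_eq_cvg; near=> T.
  have T0 : 0 < T by near: T; apply: nbhs_pinfty_gt; rewrite num_real.
  rewrite normalized_sup_moment// EFinM (fineK (Gamma_fin b_alpha)).
  by rewrite max_r// divr_ge0 ?ltW// h_gt0 ?ltW.
rewrite -EFinM; apply: cvg_EFin; first exact: nearW.
apply: cvgMr_tmp; apply: cvg_powR; rewrite ?divr_gt0//.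
  by move=> T; rewrite le_max lexx.
apply: cvg_trans hL; apply: near_eq_cvg; near=> T.
have T0 : 0 < T by near: T; apply: nbhs_pinfty_gt; rewrite num_real.
by rewrite max_r// divr_ge0 ?ltW// h_gt0 ?ltW.
Unshelve. all: end_near. Qed.

Lemma normalized_sup_uniformly_integrable (beta T0 : R) :
  0 < beta < alpha -> 0 < T0 ->
  uniformly_integrable P `[T0, +oo[
    (fun T w => normalized_sup I alpha X T w `^ beta)%E.
Proof.
move=> b_alpha T0_gt0; have /andP[b0 ba] := b_alpha.
(* Any order strictly between beta and alpha would do; p is the excess for which beta * (1 + p) =
   b'. *)
pose b' := (beta + alpha) / 2; pose p := b' / beta - 1.
have b'_alpha : 0 < b' < alpha.
  by apply/andP; split; rewrite /b'; lra.
have p0 : 0 < p.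
  by rewrite subr_gt0 ltr_pdivlMr// mul1r /b'; lra.
have bp : beta + beta * p = b'.
  by rewrite /p mulrBr mulr1 addrC subrK mulrC divfK ?gt_eqF.
(* From h T <= (T + 1) * h 1 and (T + 1) / T <= 1 + 1 / T0. *)
pose C := (1 + T0^-1) * h 1.
have hC (T : R) : T0 <= T -> h T / T <= C.
  move=> TT0; have T_gt0 : 0 < T by exact: lt_le_trans TT0.
  rewrite ler_pdivrMr// /C mulrAC.
  have := horizon_moment_linear alpha_gt0 I_domain X_process X_separable
    X_stationary X_frechet X_bounded X_spectral Z_separable (ltW T_gt0).
  move=> /le_trans; apply; rewrite ler_wpM2r ?(ltW (h_gt0 _))//.
  by rewrite mulrDl mul1r lerD2l mulrC ler_pdivlMr// mul1r.
pose M := C `^ (b' / alpha) * fine (Gamma (1 - b' / alpha)).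
rewrite /uniformly_integrable.
apply: (@squeeze_cvge _ _ _ _ (cst 0%E) _ (fun c => (c `^ (- p) * M)%:E)).
- near=> c.
  have c0 : 0 < c by near: c; apply: nbhs_pinfty_gt; rewrite num_real.
  apply/andP; split.
    apply: le_trans (ereal_sup_ubound _); last first.
      by exists T0; [rewrite /= in_itv/= lexx|reflexivity].
    by apply: integral_ge0 => w _; exact: abse_ge0.
  apply: ge_ereal_sup => _ [T TT0 <-].
  move: TT0; rewrite /= in_itv/= andbT => TT0.
  have T_gt0 : 0 < T by exact: lt_le_trans TT0.
  have [Y [mY YE Ymoment]] := normalized_sup_version T_gt0.
  (* Where v = Y ^ beta exceeds c, v <= c ^ (- p) * v ^ (1 + p) = c ^ (- p) * Y ^ b'. *)
  apply: (@le_trans _ _ (\int[P]_w ((c `^ (- p))%:E * (Y w `^ b')%:E))%E).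
    rewrite integral_mkcond; apply: ae_le_integralT => [w|w|].
    - by rewrite patchE; case: ifPn => // _; exact: abse_ge0.
    - by rewrite -EFinM lee_fin mulr_ge0 ?powR_ge0.
    apply: filterS YE => w YwE; rewrite patchE; case: ifPn; last first.
      by move=> _; rewrite -EFinM lee_fin mulr_ge0 ?powR_ge0.
    move=> /set_mem /=; rewrite YwE poweR_EFin /= ger0_norm ?powR_ge0// lte_fin.
    move=> cv.
    have v0 : 0 < Y w `^ beta by exact: lt_trans cv.
    rewrite lee_fin -bp powRD; last first.
      by apply/implyP => _; apply: contraTneq v0 => ->; rewrite powR0 ?gt_eqF// ltxx.
    rewrite powRrM mulrCA -[leLHS]mulr1 ler_wpM2l ?(ltW v0)//.
    rewrite powRN mulrC ler_pdivlMr ?powR_gt0// mul1r.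
    by rewrite ge0_ler_powR ?nnegrE ?(ltW p0) ?(ltW c0) ?(ltW v0) ?(ltW cv).
  rewrite ge0_integralZl//; last 3 first.
  - by apply/measurable_EFinP; exact: (measurableT_comp (measurable_powR b') mY).
  - by move=> w _; rewrite lee_fin powR_ge0.
  - by rewrite lee_fin powR_ge0.
  rewrite Ymoment -(fineK (Gamma_fin b'_alpha)) -!EFinM lee_fin.
  rewrite ler_wpM2l ?powR_ge0// ler_wpM2r ?fine_ge0//.
    by apply: integral_ge0 => t _; rewrite lee_fin mulr_ge0 ?powR_ge0 ?expR_ge0.
  have hT0 : 0 <= h T / T by rewrite divr_ge0 ?ltW// h_gt0 ?ltW.
  rewrite ge0_ler_powR ?nnegrE ?hC//; last exact: le_trans (hC _ TT0).
  by case/andP: b'_alpha => b'0 _; rewrite divr_ge0 ?ltW.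
- exact: cvg_cst.
- apply: cvg_EFin; first exact: nearW.
  rewrite -(mul0r M); apply: cvgMr_tmp.
  exact: cvg_powRN_pinfty.
Unshelve. all: end_near. Qed.

End normalized_suprema.

(* Uniform integrability is over T >= T0, for every T0 > 0: over all T > 0 it
   fails, since normalized_sup at T is at least T `^ (- alpha^-1) * X 0, which is
   unbounded as T tends to 0. *)
Theorem proposition3p4 (R : realType) (alpha : R) (I : set R)
    (d : measure_display) (Omega : measurableType d) (P : probability Omega R)
    (X : R -> Omega -> R)
    (d' : measure_display) (Omega' : measurableType d')
    (P' : probability Omega' R) (Z : R -> Omega' -> R)
    (alpha_gt0 : 0 < alpha)
    (I_domain : time_domain I)
    (X_process : stochastic_process I X)
    (X_separable : separable_process P I X)
    (X_stationary : stationary P I X)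
    (X_max_stable : max_stable_process P I X)
    (X_frechet : frechet_marginals P I alpha X)
    (X_bounded : locally_bounded_paths P I X)
    (X_spectral : spectral_process I alpha P X P' Z)
    (continuous_time : I = [set: R] ->
       [/\ stochastically_continuous P X,
           jointly_measurable X,
           jointly_measurable Z,
           separable_process P' I Z &
           locally_bounded_paths P' I Z]) :
  forall beta : R, 0 < beta < alpha ->
    [/\ (\int[P]_w (normalized_sup I alpha X T w `^ beta) @[T --> +oo%R] -->
          pickands P' I alpha Z `^ (beta / alpha) * Gamma (1 - beta / alpha))%E,
        (pickands P' I alpha Z `^ (beta / alpha) * Gamma (1 - beta / alpha)
          < +oo)%E &
        forall T0 : R, 0 < T0 ->
          uniformly_integrable P `[T0, +oo[
            (fun T w => normalized_sup I alpha X T w `^ beta)%E].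
Proof.
move=> beta b_alpha.
have Z_separable : I = [set: R] -> separable_process P' I Z.
  by move=> /continuous_time[].
have [mom fin] := normalized_sup_moment_cvg alpha_gt0 I_domain X_process
  X_separable X_stationary X_frechet X_bounded X_spectral Z_separable b_alpha.
split => // T0 T0_gt0.
exact: (normalized_sup_uniformly_integrable alpha_gt0 I_domain X_process
  X_separable X_stationary X_frechet X_bounded X_spectral Z_separable b_alpha).
Qed.
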